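(* Let $L/K$ be a finite (not necessarily Galois) extension of $p$-adic fields and let $H$ be a commutative Hopf algebra giving a Hopf-Galois structure on $L/K$. Suppose that $p \nmid [L:K]$. Let $\mathfrak{A}_H = \{h \in H \mid h\cdot x \in \mathfrak{O}_L \text{ for all } x \in \mathfrak{O}_L\}$ be the associated order of $\mathfrak{O}_L$ in $H$. Then $\mathfrak{O}_L$ is a free $\mathfrak{A}_H$-module.
   Context: A $p$-adic field is a finite extension of $\mathbb{Q}_p$; $\mathfrak{O}_L$ denotes the valuation ring of $L$. Hopf-Galois structures: let $L/K$ be a finite separable field extension and $H$ a finite-dimensional $K$-Hopf algebra with counit $\varepsilon$ and comultiplication $\Delta(h)=\sum_{(h)} h_{(1)}\otimes h_{(2)}$. $L$ is an $H$-module algebra if $L$ is an $H$-module with $h\cdot(st)=\sum_{(h)}(h_{(1)}\cdot s)(h_{(2)}\cdot t)$ and $h\cdot 1=\varepsilon(h)1$ for all $h\in H$, $s,t\in L$. We say $H$ gives a Hopf-Galois structure on $L/K$ (or $L/K$ is $H$-Galois) if $L$ is an $H$-module algebra and the $K$-linear map $j: L\otimes_K H\to \mathrm{End}_K(L)$, $j(s\otimes h)(t)=s(h\cdot t)$, is an isomorphism. *)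

(* Defs.v *)
From HB Require Import structures.
From mathcomp Require Import all_boot all_order all_algebra all_field.
From mathcomp Require Import finmap boolp classical_sets.
Set Implicit Arguments.
Unset Strict Implicit.
Unset Printing Implicit Defensive.
Import GRing.Theory VectorInternalTheory.
Local Open Scope ring_scope.

(* Z_p is the inverse limit of the rings Z/p^n: an element is a sequence x    *)
(* of residues x n < p ^ n with x n.+1 = x n mod p ^ n.                       *)
Definition coherent (p : nat) (x : nat -> nat) : bool :=
  `[< forall n, (x n < p ^ n)%N /\ (x n.+1 %% p ^ n)%N = x n >].

Record padic_int (p : nat) (pr_p : prime p) := PadicInt {
  residue :> nat -> nat;
  residueP : coherent p residue }.

HB.instance Definition _ p pr_p := [isSub for @residue p pr_p].
HB.instance Definition _ p pr_p := [Equality of @padic_int p pr_p by <:].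
HB.instance Definition _ p pr_p := [Choice of @padic_int p pr_p by <:].

Section PadicIntRing.
Context (p : nat) (pr_p : prime p).
Local Notation Zp := (padic_int pr_p).
Implicit Types x y z : Zp.
Local Open Scope nat_scope.

Let pn_gt0 n : 0 < p ^ n. Proof. by rewrite expn_gt0 prime_gt0. Qed.

Lemma residue_lt x n : x n < p ^ n.
Proof. by have /asboolP/(_ n)[] := residueP x. Qed.

Lemma residue_mod x n m : n <= m -> x m %% p ^ n = x n.
Proof.
elim: m => [|m IHm]; first by rewrite leqn0 => /eqP->; rewrite modn_small ?residue_lt.
rewrite leq_eqVlt => /predU1P[->|]; first by rewrite modn_small ?residue_lt.
rewrite ltnS => le_nm; rewrite -(IHm le_nm).
have /asboolP/(_ m)[_ <-] := residueP x.
by rewrite modn_dvdm // dvdn_exp2l.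
Qed.

Lemma padic_int_ext x y : (forall n, x n = y n) -> x = y.
Proof. by move=> xy; apply/val_inj/funext. Qed.

Lemma reduce_coherent (f : nat -> nat) :
  (forall n, f n.+1 = f n %[mod p ^ n]) -> coherent p (fun n => f n %% p ^ n).
Proof.
move=> fP; apply/asboolP => n; rewrite ltn_pmod //; split=> //.
by rewrite modn_dvdm ?dvdn_exp2l // fP.
Qed.

Definition reduce (f : nat -> nat) fP : Zp := PadicInt pr_p (@reduce_coherent f fP).

Let residueS x n : x n.+1 = x n %[mod p ^ n].
Proof. by rewrite residue_mod // [RHS]modn_small ?residue_lt. Qed.

Fact const_subproof (k : nat) n : k = k %[mod p ^ n]. Proof. by []. Qed.
Fact add_subproof x y n : x n.+1 + y n.+1 = x n + y n %[mod p ^ n].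
Proof. by rewrite -modnDm !residueS modnDm. Qed.
Fact mul_subproof x y n : x n.+1 * y n.+1 = x n * y n %[mod p ^ n].
Proof. by rewrite -modnMm !residueS modnMm. Qed.
Fact opp_subproof x n : p ^ n.+1 - x n.+1 = p ^ n - x n %[mod p ^ n].
Proof.
apply/eqP; rewrite -(eqn_modDr (x n.+1)) subnK ?(ltnW (residue_lt _ _)) //.
rewrite -modnDmr residueS modnDmr subnK ?(ltnW (residue_lt _ _)) //.
by rewrite expnS modnMl modnn.
Qed.

Definition padic0 := reduce (const_subproof 0).
Definition padic1 := reduce (const_subproof 1).
Definition padic_add x y := reduce (add_subproof x y).
Definition padic_opp x := reduce (opp_subproof x).
Definition padic_mul x y := reduce (mul_subproof x y).

Fact padic_addA : associative padic_add.
Proof. by move=> x y z; apply: padic_int_ext => n /=; rewrite modnDml modnDmr addnA. Qed.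
Fact padic_addC : commutative padic_add.
Proof. by move=> x y; apply: padic_int_ext => n /=; rewrite addnC. Qed.
Fact padic_add0 : left_id padic0 padic_add.
Proof.
by move=> x; apply: padic_int_ext => n /=; rewrite mod0n add0n modn_small ?residue_lt.
Qed.
Fact padic_addN : left_inverse padic0 padic_opp padic_add.
Proof.
move=> x; apply: padic_int_ext => n /=.
by rewrite modnDml subnK ?(ltnW (residue_lt _ _)) // modnn mod0n.
Qed.
HB.instance Definition _ :=
  GRing.isZmodule.Build Zp padic_addA padic_addC padic_add0 padic_addN.

Fact padic_mulA : associative padic_mul.
Proof. by move=> x y z; apply: padic_int_ext => n /=; rewrite modnMml modnMmr mulnA. Qed.
Fact padic_mulC : commutative padic_mul.
Proof. by move=> x y; apply: padic_int_ext => n /=; rewrite mulnC. Qed.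
Fact padic_mul1 : left_id padic1 padic_mul.
Proof.
by move=> x; apply: padic_int_ext => n /=; rewrite modnMml mul1n modn_small ?residue_lt.
Qed.
Fact padic_mulDl : left_distributive padic_mul padic_add.
Proof.
by move=> x y z; apply: padic_int_ext => n /=; rewrite modnMml modnDm mulnDl.
Qed.
Fact padic1_neq0 : padic1 != 0%R.
Proof.
apply/eqP => /(congr1 (fun x : Zp => x 1)) /=.
by rewrite expn1 mod0n modn_small ?prime_gt1.
Qed.
HB.instance Definition _ := GRing.Zmodule_isComNzRing.Build Zp
  padic_mulA padic_mulC padic_mul1 padic_mulDl padic1_neq0.

Definition padic_unit : {pred Zp} := fun x => `[< exists y, (y * x = 1)%R >].
Definition padic_inv x : Zp :=
  if pselect (exists y, (y * x = 1)%R) is left ex then sval (cid ex) else x.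

Fact padic_mulV : {in padic_unit, left_inverse 1%R padic_inv *%R}.
Proof.
move=> x /asboolP ux; rewrite /padic_inv; case: pselect => // ex.
by case: cid.
Qed.
Fact padic_unitP x y : (y * x = 1)%R -> padic_unit x.
Proof. by move=> yx; apply/asboolP; exists y. Qed.
Fact padic_inv_out : {in [predC padic_unit], padic_inv =1 id}.
Proof.
move=> x /asboolPn nux; rewrite /padic_inv; case: pselect => // ex.
Qed.
HB.instance Definition _ := GRing.ComNzRing_hasMulInverse.Build Zp
  padic_mulV padic_unitP padic_inv_out.

Fact padic_mul_eq0 : GRing.integral_domain_axiom Zp.
Proof.
have nz x : x != 0%R -> exists2 n, 0 < x n & logn p (x n) < n.
  move=> /eqP x0; have [n xn0] : exists n, x n != 0.
    apply: contra_notP x0 => /forallNP x0; apply: padic_int_ext => n /=.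
    by rewrite mod0n; apply/eqP; have /negP := x0 n; rewrite negbK.
  exists n; rewrite ?lt0n // ltnNge -pfactor_dvdn ?lt0n //.
  by apply: contra xn0 => /eqP <-; rewrite modn_small ?residue_lt.
have lift x n m : logn p (x n) < n -> 0 < x n -> n <= m ->
    0 < x m /\ logn p (x m) < n.
  move=> ln xn0 nm; have xm : ~~ (p ^ n %| x m).
    by rewrite /dvdn residue_mod // -lt0n.
  have xm0 : 0 < x m by rewrite lt0n; apply: contraNneq xm => ->.
  by split=> //; rewrite ltnNge -pfactor_dvdn.
move=> x y xy0; apply/norP => -[/nz[n xn0 ln] /nz[m ym0 lm]].
have [xN0 lx] := lift _ _ _ ln xn0 (leq_addr m n).
have [yN0 ly] := lift _ _ _ lm ym0 (leq_addl n m).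
have /= := congr1 (fun z : Zp => z (n + m)) xy0; rewrite mod0n => /eqP.
rewrite -/(_ %| _) pfactor_dvdn ?muln_gt0 ?xN0 // lognM // leqNgt.
by rewrite -addnS leq_add // ltnW.
Qed.
HB.instance Definition _ := GRing.ComUnitRing_isIntegral.Build Zp padic_mul_eq0.

End PadicIntRing.

Definition padic (p : nat) (pr_p : prime p) : fieldType :=
  {fraction (padic_int pr_p)}.

(* The value of v at 0 (conventionally +oo) is left unspecified.              *)
Record is_valuation (F : fieldType) (v : F -> rat) : Prop := IsValuation {
  valuationM : forall x y, x != 0 -> y != 0 -> v (x * y) = v x + v y;
  valuationD : forall x y, x != 0 -> y != 0 -> x + y != 0 ->
    Num.min (v x) (v y) <= v (x + y) }.

(* v, composed with the embedding iota of Q_p, is the p-adic valuation: it    *)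
(* maps p ^ n * u to n for every p-adic unit u.                               *)
Definition extends_padic_valuation (p : nat) (pr_p : prime p) (F : fieldType)
    (iota : padic pr_p -> F) (v : F -> rat) : Prop :=
  is_valuation v /\
  forall (n : nat) (u : padic_int pr_p), u \is a GRing.unit ->
    v (iota (tofrac (p%:R ^+ n * u))) = n%:R.

Definition valuation_ring (F : fieldType) (v : F -> rat) : set F :=
  [set x | x = 0 \/ 0 <= v x]%classic.

Definition tower_embedding (F : fieldType) (K : fieldExtType F)
  (L : fieldExtType K) (x : F) : L := (x%:A : K)%:A.

(* The tensor product of finite-dimensional spaces, in coordinates: tens u v  *)
(* is the matrix of products of coordinates. Lemmas tlift_tens and            *)
(* tens_ext are its universal property.                                       *)
Section Tensor.
Context {K : fieldType}.
Implicit Types U V W : vectType K.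

Definition tensor U V : vectType K := 'M[K]_(dim U, dim V).

Definition tens U V (u : U) (v : V) : tensor U V := (v2r u)^T *m v2r v.

Definition bilinear_map U V W (f : U -> V -> W) : Prop :=
  (forall u, linear (f u)) /\ (forall v, linear (f ^~ v)).

(* For bilinear f, the linear map sending tens u v to f u v.                  *)
Definition tlift U V W (f : U -> V -> W) (t : tensor U V) : W :=
  \sum_i \sum_j (t : 'M_(_, _)) i j *:
    f (r2v (delta_mx 0 i)) (r2v (delta_mx 0 j)).

Lemma tlift_is_linear U V W (f : U -> V -> W) : linear (tlift f).
Proof.
move=> a s t; rewrite /tlift scaler_sumr -big_split /=; apply: eq_bigr => i _.
rewrite scaler_sumr -big_split /=; apply: eq_bigr => j _.
by rewrite !mxE scalerDl scalerA.
Qed.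
HB.instance Definition _ U V W (f : U -> V -> W) :=
  GRing.isLinear.Build K (tensor U V) W _ (tlift f) (tlift_is_linear f).

Let linear_sum_coord U W (g : U -> W) (u : U) : linear g ->
  \sum_i v2r u 0 i *: g (r2v (delta_mx 0 i)) = g u.
Proof.
move=> gL; pose gl : {linear U -> W} :=
  HB.pack g (GRing.isLinear.Build K U W _ g gL).
rewrite -[RHS]/(gl u) -[u in RHS]v2rK [v2r u in RHS]row_sum_delta !linear_sum.
by apply: eq_bigr => i _; rewrite !linearZ.
Qed.

Lemma tlift_tens U V W (f : U -> V -> W) : bilinear_map f ->
  forall u v, tlift f (tens u v) = f u v.
Proof.
move=> [fr fl] u v; rewrite -(linear_sum_coord u (fl v)) /tlift.
apply: eq_bigr => i _; rewrite -(linear_sum_coord v (fr _)) scaler_sumr.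
by apply: eq_bigr => j _; rewrite scalerA !mxE big_ord1 !mxE.
Qed.

Lemma tens_bilinear U V : bilinear_map (@tens U V).
Proof.
split=> [u|v] a x y; rewrite /tens linearP /=.
  by rewrite mulmxDr -scalemxAr.
by rewrite linearP /= mulmxDl -scalemxAl.
Qed.

Lemma tens_ext U V W (f g : {linear tensor U V -> W}) :
  (forall u v, f (tens u v) = g (tens u v)) -> f =1 g.
Proof.
move=> fg t; rewrite [t]matrix_sum_delta !linear_sum; apply: eq_bigr => i _.
rewrite !linear_sum; apply: eq_bigr => j _; rewrite !linearZ; congr (_ *: _).
suff -> : delta_mx i j = tens (r2v (delta_mx 0 i)) (r2v (delta_mx 0 j)) by [].
by rewrite /tens !r2vK trmx_delta mul_delta_mx.
Qed.

End Tensor.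

(* In Sweedler notation, tlift f (comul h) is the sum of the f h_(1) h_(2).   *)
Record hopf_algebra (K : fieldType) (H : falgType K) := HopfAlgebra {
  comul : {linear H -> tensor H H};
  counit : {lrmorphism H -> K^o};
  antipode : {linear H -> H};
  comul1 : comul 1 = tens 1 1;
  comulM : forall g h, comul (g * h) =
    tlift (fun g1 g2 => tlift (fun h1 h2 => tens (g1 * h1) (g2 * h2)) (comul h))
      (comul g);
  comulA : forall h,
    tlift (fun h1 h2 => tlift (fun h11 h12 => tens h11 (tens h12 h2)) (comul h1))
      (comul h) =
    tlift (fun h1 h2 => tlift (fun h21 h22 => tens h1 (tens h21 h22)) (comul h2))
      (comul h);
  counitl : forall h, tlift (fun h1 h2 => (counit h1 : K) *: h2) (comul h) = h;
  counitr : forall h, tlift (fun h1 h2 => (counit h2 : K) *: h1) (comul h) = h;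
  antipodel : forall h,
    tlift (fun h1 h2 => antipode h1 * h2) (comul h) = (counit h : K)%:A;
  antipoder : forall h,
    tlift (fun h1 h2 => h1 * antipode h2) (comul h) = (counit h : K)%:A }.

Section HopfGalois.
Context (K : fieldType) (H : falgType K) (hH : hopf_algebra H).
Context (L : fieldExtType K) (act : {linear H -> 'End(L)}).

Record is_module_algebra : Prop := IsModuleAlgebra {
  act1 : forall t, act 1 t = t;
  actM : forall g h t, act (g * h) t = act g (act h t);
  act_mul : forall h s t,
    act h (s * t) = tlift (fun h1 h2 => act h1 s * act h2 t) (comul hH h);
  act_one : forall h, act h 1 = (counit hH h : K)%:A }.

(* The map j; amull s is multiplication by s.                                 *)
Definition galois_map : tensor L H -> 'End(L) :=
  tlift (fun (s : L) (h : H) => (amull s \o act h)%VF).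

Definition is_hopf_galois : Prop := is_module_algebra /\ bijective galois_map.

Definition associated_order (O : set L) : set H :=
  [set h | forall x, O x -> O (act h x)]%classic.

(* M has an A-basis b: every element of M is a unique finite A-linear         *)
(* combination of the b i.                                                    *)
Definition is_free_module (A : set H) (M : set L) : Prop :=
  exists (I : choiceType) (b : I -> L), (forall i, M (b i)) /\
    forall x, M x -> exists! c : {fsfun I -> H with 0},
      (forall i, A (c i)) /\ x = \sum_(i <- finsupp c) act (c i) (b i).

End HopfGalois.

(* Main.v *)
Require Import Defs.
From HB Require Import structures.
From mathcomp Require Import all_boot all_order all_algebra all_field.
From mathcomp Require Import boolp classical_sets.
From mathcomp Require Import fingroup perm cyclic finmap ring lra.
Set Implicit Arguments.
Unset Strict Implicit.
Unset Printing Implicit Defensive.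
Import Order.TTheory GRing.Theory Num.Theory VectorInternalTheory.
Local Open Scope ring_scope.

(* Over a splitting field of L the n = [L : K] embeddings s_i of L turn H into  *)
(* an algebra of commuting matrices a(h), with s_i (h x) = sum_t a(h)_it s_t x. *)
(* The Hopf-Galois condition makes the entries of each row a basis of the dual  *)
(* of H, and the comultiplication makes them orthogonal idempotents there; so   *)
(* any two rows agree up to a permutation, and a(h) is a combination of         *)
(* commuting permutation matrices with coefficients the entries of one row.     *)
(* Hence n times an entry of a(h) is the trace of a(h) times a permutation      *)
(* matrix commuting with it.  When h is integral over Z_p so is that trace, and *)
(* n is a unit, so the entry is integral: h preserves the integral elements of  *)
(* L, which by Hensel's lemma are those of nonnegative valuation.  Nilpotent    *)
(* elements thus act as 0, so H is reduced and splits into fields H e; on each  *)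
(* of them every element or its inverse is integral, again by Hensel's lemma,   *)
(* and an element of e O_L which is maximal for divisibility generates it over  *)
(* the integral elements of H e.                                                *)

(** * Arithmetic of Z_p *)

(** The valuation ring O_L consists of the elements of L integral over Z_p ([valuation_ringP]), and
    integrality also governs the associated order. Two facts carry the proof.

    Integral elements of H preserve O_L ([hopf_galois_integral]). Over a splitting field, H acts
    like the group algebra of an abelian group of order n = [L : K] permuting the embeddings. A
    coefficient of h there is 1/n times the trace of h composed with a group element, as in Fourier
    inversion. This trace is a sum of integral eigenvalues and n is a unit of Z_p
    ([embedding_mx_integral]).

    Some b in O_L has the property that h b lies in O_L only for integral h ([lattice_generator]). H
    is a product of fields, the integral elements of each factor behave like a discrete valuation
    ring, and a lattice over such a ring has a generator.

    Since H and L have the same dimension ([hopf_galois_dim]), h |-> h b is a bijection from H to L,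
    and it matches the integral elements with O_L. These elements are the associated order, so b is
    a basis. The p-adic input to both the description of O_L and the generator is
    [inverse_integral_or_nilpotent], which rests on [hensel_factor]. *)

Section PadicIntegers.
Context (p : nat) (pr_p : prime p).
Local Notation Zp := (padic_int pr_p).
Implicit Types x y : Zp.

Lemma residue0 n : residue (0 : Zp) n = 0%N.
Proof. by rewrite /= mod0n. Qed.

Lemma residueD x y n : residue (x + y) n = ((x n + y n) %% p ^ n)%N.
Proof. by []. Qed.

Lemma residueM x y n : residue (x * y) n = ((x n * y n) %% p ^ n)%N.
Proof. by []. Qed.

Lemma residue_nat m n : residue (m%:R : Zp) n = (m %% p ^ n)%N.
Proof.
elim: m => [|m IHm]; first by rewrite residue0 mod0n.
by rewrite -natr1 residueD IHm /= modnDm addn1.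
Qed.

(** If the residue mod p is nonzero, all residues are prime to p, and Euler's theorem inverts the
    one mod p^n by a power. Uniqueness of inverses makes these powers coherent. *)
Lemma padic_unitE x : (x \is a GRing.unit) = (x 1%N != 0%N).
Proof.
have p_gt0 := prime_gt0 pr_p.
apply/idP/idP => [/unitrP[y [yx1 _]]|x1].
  apply: contra_eq_neq (congr1 (fun z : Zp => z 1%N) yx1) => x10.
  by rewrite residueM x10 muln0 mod0n /= expn1 modn_small ?prime_gt1.
have cox n : coprime (x n) (p ^ n).
  case: n => [|n]; first by rewrite coprimen1.
  rewrite coprime_sym coprimeXl // prime_coprime //.
  by apply: contra x1 => /dvdnP[k Dk]; rewrite -(residue_mod x (ltn0Sn n)) Dk expn1 modnMl.
have xS n : (x n.+1 = x n %[mod p ^ n])%N by rewrite residue_mod ?modn_small ?residue_lt.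
have mulV a n : coprime a (p ^ n) -> (a ^ (totient (p ^ n)).-1 * a = 1 %[mod p ^ n])%N.
  move=> co_a; rewrite -expnSr prednK; first exact: Euler_exp_totient.
  by rewrite totient_gt0 expn_gt0 p_gt0.
pose f n := (x n ^ (totient (p ^ n)).-1)%N.
have fP n : (f n.+1 = f n %[mod p ^ n])%N.
  have fS : (f n.+1 * x n = 1 %[mod p ^ n])%N.
    rewrite -modnMmr -xS modnMmr -(@modn_dvdm (p ^ n.+1)) ?dvdn_exp2l // mulV //.
    by rewrite modn_dvdm ?dvdn_exp2l.
  rewrite -[f n.+1 in LHS]muln1 -modnMmr -(mulV _ _ (cox n)) modnMmr.
  by rewrite mulnCA -modnMmr fS modnMmr muln1.
pose y : Zp := reduce pr_p fP.
have yx : y * x = 1 by apply: padic_int_ext => n; rewrite residueM /= modnMml mulV.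
by apply/unitrP; exists y; split; rewrite // mulrC.
Qed.

(** Dividing by p costs one digit: the quotient mod p^n is read off x mod p^(n+1). *)
Lemma padic_nonunit x : x \isn't a GRing.unit -> exists y, x = p%:R * y.
Proof.
have p_gt0 := prime_gt0 pr_p.
rewrite padic_unitE negbK => /eqP x1.
have dvd_x n : (p %| x n.+1)%N.
  by rewrite /dvdn -{2}(expn1 p) residue_mod // x1.
have fP n : (x n.+2 %/ p = x n.+1 %/ p %[mod p ^ n])%N.
  have xE := residue_mod x (leqnSn n.+1).
  rewrite [x n.+2 in LHS](divn_eq _ (p ^ n.+1)) xE divnDr // expnSr mulnA mulnK //.
  by rewrite modnMDl.
exists (reduce pr_p fP); apply: padic_int_ext => n.
rewrite residueM residue_nat /= modnMmr modnMml.
case: n => [|n]; first by rewrite modn1; have := residue_lt x 0; case: (x _).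
by rewrite mulnC divnK // residue_mod.
Qed.

Lemma padic_neq0 x : x != 0 -> exists n u, u \is a GRing.unit /\ x = p%:R ^+ n * u.
Proof.
move=> x0; have [n] : exists n, x n != 0%N.
  apply: contra_neqP x0 => /forallNP x0; apply: padic_int_ext => n.
  by rewrite residue0; apply/eqP; have /negP := x0 n; rewrite negbK.
elim: n => [|n IHn] in x {x0} *.
  by have := residue_lt x 0; rewrite expn0; case: (x 0).
have [ux _|/padic_nonunit[y ->]] := boolP (x \is a GRing.unit).
  by exists 0%N, x; rewrite mul1r.
rewrite residueM residue_nat modnMml => y0.
have {y0} /IHn[m [u [uu ->]]] : y n != 0%N.
  apply: contraNneq y0 => yn0; rewrite -(@residue_mod _ _ y n n.+1) // in yn0.
  by have /dvdnP[k ->] : (p ^ n %| y n.+1)%N; [apply/eqP | rewrite mulnCA -expnS modnMl].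
by exists m.+1, u; rewrite exprS mulrA.
Qed.

Lemma residue_expn_eq0 n x : (x n == 0)%N <-> exists y, x = p%:R ^+ n * y.
Proof.
split=> [|[y ->]]; last by rewrite -natrX residueM residue_nat modnn mul0n mod0n.
have [-> _|/padic_neq0[m [u [uu ->]]]] := eqVneq x 0; first by exists 0; rewrite mulr0.
have [le_nm _|lt_mn] := leqP n m.
  by exists (p%:R ^+ (m - n) * u); rewrite mulrA -exprD subnKC.
rewrite -natrX residueM residue_nat modnMml -/(_ %| _)%N => dvd_n.
have u1 : (u n %% p != 0)%N.
  have := @residue_mod _ _ u 1 n (leq_ltn_trans (leq0n _) lt_mn).
  by rewrite expn1 => ->; rewrite -padic_unitE.
have : (p ^ m.+1 %| p ^ m * u n)%N by apply: dvdn_trans dvd_n; apply: dvdn_exp2l.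
by rewrite expnSr dvdn_pmul2l ?expn_gt0 ?prime_gt0 // /dvdn (negPf u1).
Qed.

Lemma padic_natp_neq0 n : (p%:R ^+ n : Zp) != 0.
Proof.
apply: contra_eq_neq (residue_nat (p ^ n) n.+1) => p0.
rewrite natrX p0 residue0 eq_sym modn_small ?ltn_exp2l ?prime_gt1 //.
by rewrite -lt0n expn_gt0 prime_gt0.
Qed.

Lemma padic_separated x : (forall n, exists y, x = p%:R ^+ n * y) -> x = 0.
Proof.
move=> xP; apply: padic_int_ext => n; rewrite residue0; apply/eqP.
exact/residue_expn_eq0/xP.
Qed.

(** The limit is the diagonal sequence of the residues [u n n]. *)
Lemma padic_complete (u d : nat -> Zp) :
    (forall n, u n.+1 = u n + p%:R ^+ n * d n) ->
  exists l, forall n, exists y, l = u n + p%:R ^+ n * y.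
Proof.
move=> uS; have pn_eq n x y : residue (x + p%:R ^+ n * y) n = x n.
  rewrite residueD residueM -natrX residue_nat modnn mul0n mod0n addn0.
  by rewrite modn_small ?residue_lt.
have lP : coherent p (fun n => u n n).
  apply/asboolP => n; rewrite residue_lt; split=> //.
  by rewrite residue_mod // uS pn_eq.
exists (PadicInt pr_p lP) => n.
suff /residue_expn_eq0[y Dy] : residue (PadicInt pr_p lP - u n) n == 0%N.
  by exists y; rewrite -Dy addrC subrK.
have -> : PadicInt pr_p lP - u n = 0 + (PadicInt pr_p lP - u n) by rewrite add0r.
rewrite add0r residueD /= modnDmr subnKC ?modnn //.
exact/ltnW/residue_lt.
Qed.

End PadicIntegers.

(** * Hensel's lemma *)

(** This is the truncated inverse of a power series with unit constant term; each step cancels the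
    lowest coefficient of the error [q]. *)
Lemma inv_mod_Xn (R : comUnitRingType) (h : {poly R}) a :
  h`_0 \is a GRing.unit -> exists w q, w * h = 1 + q * 'X^a.
Proof.
move=> h0; elim: a => [|a [w [q wh]]].
  by exists 0, (-1); rewrite mul0r expr0 mulr1 subrr.
pose c := q`_0 / h`_0; pose e := q - c%:P * h.
have e0 : take_poly 1 e = 0.
  apply/polyP => i; rewrite coef_take_poly coef0; case: i => //=.
  by rewrite coefB coefCM divrK ?subrr.
exists (w - c%:P * 'X^a), (drop_poly 1 e).
rewrite mulrBl wh exprS mulrA -[X in _ * X * _]expr1.
rewrite -[X in _ = _ + X * _](add0r _) -e0 poly_take_drop /e mulrBl addrA -!mulrA.
by rewrite ['X^a * h]mulrC.
Qed.

Lemma poly_divC (R : comNzRingType) (c : R) (f : {poly R}) :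
  (forall j, exists y, f`_j = c * y) -> exists q, f = c%:P * q.
Proof.
move=> /choice[y yP]; exists (\poly_(j < size f) y j); apply/polyP => j.
rewrite coefCM coef_poly; case: ltnP => // /leq_sizeP fj.
by rewrite mulr0 fj.
Qed.

Section Hensel.
Import Pdiv.Ring Pdiv.RingMonic.
Context (p : nat) (pr_p : prime p).
Local Notation Zp := (padic_int pr_p).
Local Notation P := (p%:R%:P : {poly Zp}).

(* The lifted factors are 'X^a + P * r and h + P * u, and P ^+ j.+1 * s is   *)
(* the current error.                                                         *)
Let step (a : nat) (h w : {poly Zp}) (j : nat) (t : {poly Zp} * {poly Zp} * {poly Zp}) :=
  let: (r, u, s) := t in
  let d := take_poly a (w * s) in
  let q := drop_poly a (s - d * h) in
  (r + P ^+ j * d, u + P ^+ j * q, - (d * u + r * q) - P ^+ j * (d * q)).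

(** Modulo p, f is X^a times a polynomial h whose constant term f_a is a unit. The two factors are
    then coprime, and the factorization lifts. Only the monic factor is taken as a limit; the other
    is the quotient of f by it. *)
Lemma hensel_factor (f : {poly Zp}) a :
    (forall j, (j < a)%N -> f`_j \isn't a GRing.unit) -> f`_a \is a GRing.unit ->
  exists g h, [/\ g \is monic, size g = a.+1 & f = g * h].
Proof.
move=> f_lt fa; pose h := drop_poly a f.
have [s0 Ds0] : exists s, take_poly a f = P * s.
  apply: poly_divC => j; rewrite coef_take_poly; case: ltnP => [/f_lt|_].
    by move=> /padic_nonunit.
  by exists 0; rewrite mulr0.
have [|w [v wh]] := @inv_mod_Xn _ h a; first by rewrite coef_drop_poly.
pose t n := iteri n (step a h w) (0, 0, s0).
pose r n := (t n).1.1; pose u n := (t n).1.2; pose s n := (t n).2.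
pose d n := take_poly a (w * s n).
(* As w inverts h modulo X^a, the error s splits as d h + q X^a, which gives one correction for each
   factor. *)
have dE n : s n - d n * h = drop_poly a (s n - d n * h) * 'X^a.
  rewrite -[LHS](poly_take_drop a) -[RHS]add0r; congr (_ + _).
  move: (poly_take_drop a (w * s n)); rewrite -/(d n).
  set D := drop_poly a (w * s n) => Ew.
  have -> : s n - d n * h = (D * h - v * s n) * 'X^a.
    have: w * h * s n = s n + v * s n * 'X^a by rewrite wh; ring.
    rewrite mulrAC -Ew => E; rewrite -[s n in LHS](addrK (v * s n * 'X^a)) -E; ring.
  by rewrite take_polyMXn subnn /= take_poly0l mul0r.
have rS n : r n.+1 = r n + P ^+ n * d n.
  by rewrite /r /t /= -/(t n) /step /d /s; case: (t n) => [[]].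
have uS n : u n.+1 = u n + P ^+ n * drop_poly a (s n - d n * h).
  by rewrite /u /t /= -/(t n) /step /d /s; case: (t n) => [[]].
have sS n : s n.+1 = - (d n * u n + r n * drop_poly a (s n - d n * h))
                     - P ^+ n * (d n * drop_poly a (s n - d n * h)).
  by rewrite {1}/s /t /= -/(t n) /step /d /r /u /s; case: (t n) => [[]].
have fE n : f = ('X^a + P * r n) * (h + P * u n) + P ^+ n.+1 * s n.
  elim: n => [|n IHn].
    by rewrite /r /u /s /= !mulr0 !addr0 expr1 -Ds0 addrC mulrC poly_take_drop.
  rewrite {1}IHn rS uS sS; move: (dE n); set q := drop_poly a _ => E.
  have -> : s n = d n * h + q * 'X^a by rewrite -E addrC subrK.
  rewrite !exprS. ring.
have szr n : (size (r n) <= a)%N.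
  elim: n => [|n IHn]; first by rewrite /r size_poly0.
  rewrite rS (leq_trans (size_polyD _ _)) // geq_max IHn -polyC_exp mul_polyC.
  by rewrite (leq_trans (size_scale_leq _ _)) ?size_take_poly.
have /choice[l lP] j : exists l, forall n, exists y, l = (r n)`_j + p%:R ^+ n * y.
  apply: (@padic_complete _ _ _ (fun n => (d n)`_j)) => n.
  by rewrite rS coefD -polyC_exp coefCM.
pose g := 'X^a + P * \poly_(j < a) l j.
have sz_low : (size (P * \poly_(j < a) l j)%R < size ('X^a : {poly Zp}))%N.
  by rewrite size_polyXn ltnS mul_polyC (leq_trans (size_scale_leq _ _)) ?size_poly.
have mon_g : g \is monic by rewrite monicE lead_coefDl // lead_coefXn.
have sz_g : size g = a.+1 by rewrite size_polyDl // size_polyXn.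
exists g, (rdivp f g); split=> //.
rewrite {1}(rdivp_eq mon_g f) mulrC -[RHS]addr0; congr (_ + _).
have gE n : exists y, g = 'X^a + P * r n + P ^+ n * y.
  have [|y Dy] := @poly_divC _ (p%:R ^+ n) (\poly_(j < a) l j - r n).
    move=> j; rewrite coefB coef_poly; case: ltnP => [_|le_aj].
      by have [y ->] := lP j n; exists y; rewrite addrC addKr.
    by exists 0; rewrite mulr0 sub0r nth_default ?oppr0 // (leq_trans (szr n)).
  exists (P * y); rewrite /g -(subrK (r n) (\poly_(j < a) l j)) Dy polyC_exp; ring.
(* The remainder of f by g vanishes because it is divisible by every p^n. *)
apply/polyP => j; rewrite coef0; apply: padic_separated => n.
have [y gn] := gE n.
have : f = (h + P * u n) * g + (p%:R ^+ n) *: (P * s n - y * (h + P * u n)).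
  by rewrite {1}(fE n) gn -mul_polyC polyC_exp exprS; ring.
move=> /(congr1 (fun x => rmodp x g)).
rewrite rmodpD // rmodp_mull // add0r.
rewrite rmodpZ // => ->; rewrite coefZ; by eexists.
Qed.

End Hensel.

(** * Integrality over Z_p *)

Lemma fraction_num_den (R : idomainType) (x : {fraction R}) :
  exists n d : R, d != 0 /\ x * tofrac d = tofrac n.
Proof.
elim/quotW: x => y; exists (\n_y), (\d_y); split; first exact: denom_ratioP.
unlock FracField.tofrac; rewrite -[LHS]FracField.pi_mul.
apply/eqmodP; rewrite /= FracField.equivfE /FracField.mulf.
by rewrite !numden_Ratio ?mulf_neq0 ?oner_eq0 ?denom_ratioP // !mulr1 mulrC.
Qed.

Lemma fraction_poly_num_den (R : idomainType) (f : {poly {fraction R}}) :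
  exists (d : R) F, d != 0 /\ tofrac d *: f = map_poly (@FracField.tofrac R) F.
Proof.
elim/poly_ind: f => [|f c [d [F [d0 dF]]]].
  by exists 1, 0; rewrite oner_eq0 scaler0 rmorph0.
have [n [e [e0 ce]]] := fraction_num_den c.
exists (d * e), (e *: F * 'X + (d * n)%:P); rewrite mulf_neq0 //; split=> //.
rewrite rmorphD [X in _ = X + _]rmorphM /= map_polyX map_polyC map_polyZ /=.
rewrite -dF !rmorphM /= -ce scalerDr; congr (_ + _).
  by rewrite scalerAl scalerA [tofrac d * _]mulrC.
by rewrite -mul_polyC -[LHS]polyCM mulrAC -mulrA polyCM.
Qed.

Lemma horner_map_sum (R S : nzRingType) (f : {rmorphism R -> S}) (q : {poly R}) x n :
  (size q <= n)%N -> (map_poly f q).[x] = \sum_(j < n) f q`_j * x ^+ j.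
Proof.
move=> szq; rewrite (horner_coef_wide _ (leq_trans (size_poly _ _) szq)).
by apply: eq_bigr => j _; rewrite coef_map.
Qed.

Section IntegralClosure.
Context (R K : comNzRingType) (f : {rmorphism R -> K}).

Lemma integral_exp (x : K) n : integralOver f x -> integralOver f (x ^+ n).
Proof.
by move=> xP; elim: n => [|n]; [apply: integral1 | rewrite exprS; apply: integral_mul].
Qed.

Lemma integral_exp_root (x : K) n :
  (0 < n)%N -> integralOver f (x ^+ n) -> integralOver f x.
Proof.
move=> n_gt0 xP; apply: (@integral_root_monic _ _ _ _ ('X^n - (x ^+ n)%:P)).
- by rewrite monicXnsubC.
- by rewrite /root !hornerE subrr.
apply/integral_poly => j; rewrite coefB coefXn coefC.
apply: integral_sub; first exact: integral_nat.
by case: ifP => // _; apply: integral0.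
Qed.

Lemma integral_sum I (r : seq I) (P : pred I) (F : I -> K) :
  (forall j, P j -> integralOver f (F j)) -> integralOver f (\sum_(j <- r | P j) F j).
Proof.
by move=> FP; apply: big_ind => //; [apply: integral0 | apply: integral_add].
Qed.

End IntegralClosure.

Section PadicAlgebra.
Context (p : nat) (pr_p : prime p).
Local Notation Zp := (padic_int pr_p).
Local Notation Qp := (padic pr_p).

Definition zp_map (A : nzRingType) (i : {rmorphism Qp -> A}) : {rmorphism Zp -> A} :=
  i \o @FracField.tofrac Zp.

(** After clearing denominators, p is divided out until some coefficient is a unit; the power of p
    in the leading coefficient bounds the number of divisions. *)
Lemma padic_primitive (f : {poly Qp}) : f != 0 ->
  exists c F, [/\ c != 0, c *: f = map_poly (@FracField.tofrac Zp) F &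
    exists j, F`_j \is a GRing.unit].
Proof.
move=> f0; have [d [F [d0 dF]]] := fraction_poly_num_den f.
have F0 : F != 0.
  apply: contraNneq f0 => F0; move/eqP: dF; rewrite F0 rmorph0 scaler_eq0.
  by rewrite tofrac_eq0 (negPf d0).
have [k [G [FG Gu]]] : exists k G, F = p%:R ^+ k *: G /\ exists j, G`_j \is a GRing.unit.
  have lF : F`_(size F).-1 != 0 by rewrite -lead_coefE lead_coef_eq0.
  have [m [u [uu]]] := padic_neq0 lF; move: (_.-1) => j; elim: m F {d0 dF F0 lF} => [|m IHm] F Fj.
    by exists 0%N, F; rewrite expr0 scale1r; split=> //; exists j; rewrite Fj mul1r.
  have [[l Fl]|nuF] := pselect (exists l, F`_l \is a GRing.unit).
    by exists 0%N, F; rewrite expr0 scale1r; split=> //; exists l.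
  have [|G DF] := @poly_divC _ (p%:R : Zp) F.
    by move=> l; apply: padic_nonunit; apply/negP => Fl; apply: nuF; exists l.
  have [|k [G' [DG uG']]] := IHm G.
    apply: (mulfI (padic_natp_neq0 pr_p 1)).
    by rewrite expr1 mulrA -exprS -Fj DF coefCM.
  by exists k.+1, G'; rewrite {1}DF {1}DG mul_polyC scalerA -exprS.
have pk0 : (tofrac (p%:R ^+ k) : Qp) != 0 by rewrite tofrac_eq0 padic_natp_neq0.
exists ((tofrac (p%:R ^+ k))^-1 * tofrac d), G; split; last exact: Gu.
  by apply: mulf_neq0; [rewrite invr_eq0; exact: pk0 | rewrite tofrac_eq0; exact: d0].
by rewrite -scalerA dF FG map_polyZ scalerA mulVf ?scale1r.
Qed.

Context (A : comNzRingType) (i : {rmorphism Qp -> A}).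

(* The minimal polynomial of g, made primitive over Z_p, has its first unit   *)
(* coefficient at one of its two ends, by Hensel's lemma.                     *)
Lemma inverse_integral_or_nilpotent (e a g : A) (D : nat) (f : {poly Qp}) :
    e * e = e -> e != 0 ->
    (forall x y, e * x * y = 0 -> e * x = 0 \/ e * y = 0) ->
    a * g = e -> e * a = a -> e * g = g ->
    f != 0 -> (size f <= D.+1)%N -> (map_poly i f).[g] * e = 0 ->
  integralOver (zp_map i) a \/
  exists d s, [/\ (0 < d <= D)%N, integralOver (zp_map i) s & g ^+ d = p%:R * s].
Proof.
move=> ee e0 dom_e ag ea eg f0 szf fg.
(* The least such n belongs to a minimal polynomial of g in the component e A, whose unit is e. *)
pose kills n := `[< exists f : {poly Qp}, [/\ f != 0, size f = n & (map_poly i f).[g] * e = 0] >].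
have ex_n : exists n, kills n by exists (size f); apply/asboolP; exists f.
case: (ex_minnP ex_n) => n /asboolP[f1 [f10 szf1 f1g]] min_n.
have {f0 szf fg} szf : (n <= D.+1)%N.
  by apply: leq_trans szf; apply: min_n; apply/asboolP; exists f.
have [c [F [c0 cF Fu]]] := padic_primitive f10.
have [z -> evE] : exists2 z : {rmorphism Zp -> A}, zp_map i = z &
    forall G, (map_poly z G).[g] = (map_poly i (map_poly (@FracField.tofrac Zp) G)).[g].
  by exists (zp_map i) => // G; rewrite -map_poly_comp.
pose ev (G : {poly Zp}) := (map_poly z G).[g].
have evF : ev F * e = 0.
  by rewrite /ev evE -cF map_polyZ hornerZ -mulrA f1g mulr0.
have szF : size F = n.
  rewrite -szf1 -(size_scale _ c0) cF size_map_inj_poly ?rmorph0 //.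
  by move=> x y /eqP; rewrite tofrac_eq => /eqP.
have min_ev (G : {poly Zp}) : G != 0 -> (size G < n)%N -> ev G * e <> 0.
  move=> G0; rewrite ltnNge => /negP szG evG; apply: szG.
  apply: min_n; apply/asboolP; exists (map_poly (@FracField.tofrac Zp) G).
  have inj_F : injective (@FracField.tofrac Zp).
    by move=> x y /eqP; rewrite tofrac_eq => /eqP.
  by rewrite -size_poly_eq0 size_map_inj_poly ?rmorph0 // size_poly_eq0 -evE -/(ev G).
case: (ex_minnP Fu) => l Fl min_l.
have F0 : F != 0 by apply: contraTneq Fl => ->; rewrite coef0 unitr0.
have lt_l : (l < n)%N.
  by rewrite ltnNge -szF; apply: contraTN Fl => /leq_sizeP->; rewrite ?unitr0.
have [m Dn] : exists m, n = m.+1 by exists n.-1; rewrite prednK // (leq_ltn_trans _ lt_l).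
have evF_sum : ev F = \sum_(j < m.+1) z F`_j * g ^+ j.
  by apply: horner_map_sum; rewrite szF Dn.
have e_agX j k : (j <= k)%N -> a ^+ k * g ^+ j * e = a ^+ (k - j) * e.
  move=> le_jk; rewrite -{1}(subnK le_jk) exprD -!mulrA; congr (_ * _).
  rewrite mulrA -exprMn ag; elim: j {le_jk} => [|j IHj]; rewrite ?mul1r //.
  by rewrite exprS -mulrA IHj.
case: (posnP l) => [l0|l_gt0].
  left; rewrite l0 in Fl.
  (* The constant coefficient is a unit, so the reversed polynomial gives a monic equation for the
     inverse a. It holds only after multiplication by e, which the factor X absorbs since e a =
     a. *)
  exists ((\poly_(j < m.+1) ((F`_0)^-1 * F`_(m - j))) * 'X).
    rewrite monicMr ?monicX // monicE lead_coef_poly //= subnn mulVr //.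
    exact: oner_neq0.
  rewrite rmorphM /= map_polyX /root hornerM hornerX -{2}ea mulrA.
  suff -> : (map_poly (z) (\poly_(j < m.+1) ((F`_0)^-1 * F`_(m - j)))).[a] * e = 0.
    by rewrite mul0r.
  have : z ((F`_0)^-1) * a ^+ m * (ev F * e) = 0 by rewrite evF mulr0.
  move=> <-; rewrite evF_sum (horner_map_sum _ _ (size_poly _ _)).
  rewrite [RHS]mulrA mulr_sumr !mulr_suml (reindex_inj rev_ord_inj) /=.
  apply: eq_bigr => j _; rewrite coef_poly subSS ltnS leq_subr rmorphM.
  rewrite subKn -?[(j <= m)%N]ltnS ?ltn_ord // -!mulrA; congr (_ * _).
  by rewrite [RHS]mulrCA; congr (_ * _); rewrite [RHS]mulrA e_agX // -ltnS.
(* A first unit coefficient strictly between the ends would factor F; as e A is a domain, one of the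
   factors would kill g, against minimality. *)
right; have [lt_lm|le_ml] := ltnP l m.
  have [|//|G [G' [mG szG FGG]]] := @hensel_factor _ _ F l.
    by move=> j; apply: contraL => /min_l; rewrite -leqNgt.
  have G'0 : G' != 0 by apply: contraNneq F0 => G'0; rewrite FGG G'0 mulr0.
  have szG' : (size G + size G' = n.+1)%N.
    by rewrite -szF FGG size_monicM // prednK // szG.
  have : e * ev G * (e * ev G') = 0.
    rewrite mulrACA ee mulrC -[RHS]evF FGG /ev rmorphM hornerM; ring.
  have -> : e * ev G * (e * ev G') = e * ev G * ev G' by rewrite mulrACA ee mulrA.
  case/dom_e => /eqP; rewrite mulrC => /eqP ev0.
    by case: (min_ev G _ _ ev0); rewrite ?monic_neq0 // szG Dn ltnS.
  case: (min_ev G' _ _ ev0) => //.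
  by rewrite -(ltn_add2l (size G)) szG' szG addSn ltnS -add1n leq_add2r.
(* Now only the leading coefficient is a unit: g is integral, and the equation expresses g^m as p
   times an integral element. *)
have {le_ml lt_l} Dl : l = m by apply/eqP; rewrite eqn_leq le_ml -ltnS -Dn lt_l.
rewrite {}Dl in Fl min_l l_gt0.
have g_int : integralOver (z) g.
  exists ((F`_m)^-1 *: F * 'X).
    by rewrite monicMr ?monicX // monicE lead_coefZ lead_coefE szF Dn mulVr.
  rewrite rmorphM /= map_polyX map_polyZ /root hornerM hornerX hornerZ.
  by rewrite -{2}eg -!mulrA [_ * (e * _)]mulrA -/(ev F) evF mul0r mulr0.
have e_int : integralOver (z) e.
  exists ('X * ('X - 1)); first by rewrite monicMl ?monicX ?monicXsubC.
  by rewrite rmorphM rmorphB /= map_polyX rmorph1 /root !hornerE mulrBr ee mulr1 subrr.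
have /choice[y yP] (j : 'I_m) : exists y, F`_j = p%:R * y.
  by apply: padic_nonunit; apply/negP => /min_l; rewrite leqNgt ltn_ord.
exists m, (- (z ((F`_m)^-1) * \sum_(j < m) z (y j) * g ^+ j * e)); split.
- by rewrite l_gt0 -ltnS -Dn.
- apply/integral_opp/integral_mul; first exact: integral_id.
  apply: integral_sum => j _; apply: integral_mul => //; apply: integral_mul.
    exact: integral_id.
  exact: integral_exp.
have gm : g ^+ m * e = g ^+ m by rewrite -(prednK l_gt0) exprSr -mulrA [g * e]mulrC eg.
have := evF; rewrite evF_sum big_ord_recr /= mulrDl => /eqP.
rewrite addr_eq0 -mulrA gm => /eqP E; rewrite mulrN mulrCA.
have -> : p%:R * (\sum_(j < m) z (y j) * g ^+ j * e) = - (z F`_m * g ^+ m).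
  rewrite -E mulr_sumr mulr_suml; apply: eq_bigr => j _.
  by rewrite yP rmorphM rmorph_nat !mulrA.
by rewrite mulrN opprK mulrA -rmorphM mulVr // rmorph1 mul1r.
Qed.

End PadicAlgebra.

(** The powers h^0, ..., h^D are D + 1 vectors in an F-space of dimension D, hence dependent. H
    carries only its K-structure, so [phi] flattens coordinates down to F. *)
Lemma falgebra_algebraic (F : fieldType) (K : fieldExtType F) (H : falgType K) (h : H) :
  exists f : {poly F}, [/\ f != 0, (size f <= (dim H * dim K).+1)%N &
    (map_poly (in_alg H \o in_alg K) f).[h] = 0].
Proof.
pose D := (dim H * dim K)%N.
pose phi (x : H) : 'rV[F]_D := mxvec (\matrix_(i, j) v2r (v2r x 0 i) 0 j).
have phiD : {morph phi : x y / x + y}.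
  move=> x y; rewrite /phi -raddfD; congr mxvec; apply/matrixP => i j.
  by rewrite !mxE linearD mxE linearD mxE.
have phiZ (a : F) (x : H) : phi (a%:A%:A * x) = a *: phi x.
  rewrite /phi -linearZ; congr mxvec; apply/matrixP => i j; rewrite !mxE mulr_algl.
  by rewrite linearZ mxE mulr_algl linearZ mxE.
have phi0 x : phi x = 0 -> x = 0.
  move=> /(canRL mxvecK); rewrite linear0 => x0.
  apply: (can_inj v2rK); apply/rowP => i; rewrite linear0 mxE.
  apply: (can_inj v2rK); apply/rowP => j; rewrite linear0 mxE.
  by have /matrixP/(_ i j) := x0; rewrite !mxE.
pose M := \matrix_(k < D.+1) phi (h ^+ k).
have : kermx M != 0.
  by rewrite -mxrank_eq0 mxrank_ker subn_eq0 -ltnNge ltnS rank_leq_col.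
rewrite -nz_row_eq0; set u := nz_row _ => u0.
have uM : u *m M = 0 by apply/eqP; rewrite -sub_kermx nz_row_sub.
exists (\poly_(k < D.+1) u 0 (inord k)); split.
- apply: contraNneq u0 => /polyP f0; apply/eqP/rowP => k.
  by have := f0 k; rewrite coef_poly ltn_ord inord_val mxE coef0.
- exact: size_poly.
apply: phi0; rewrite -uM mulmx_sum_row (horner_map_sum _ _ (size_poly _ _)).
rewrite (big_morph phi phiD (_ : phi 0 = 0)).
  by apply: eq_bigr => k _; rewrite coef_poly ltn_ord /= phiZ inord_val rowK.
by have := phiZ 0 0; rewrite mulr0 scale0r.
Qed.

(** * The valuation ring as integral closure of Z_p *)

Section Valuation.
Context (p : nat) (pr_p : prime p) (F : fieldType).
Context (i : {rmorphism padic pr_p -> F}) (v : F -> rat).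
Hypothesis v_ext : extends_padic_valuation i v.

Let vM := valuationM v_ext.1.

Lemma valuation1 : v 1 = 0.
Proof. by have := vM (oner_neq0 F) (oner_neq0 F); rewrite mulr1; lra. Qed.

Lemma valuationX x n : x != 0 -> v (x ^+ n) = n%:R * v x.
Proof.
move=> x0; elim: n => [|n IHn]; first by rewrite mul0r valuation1.
by rewrite exprS vM ?expf_neq0 // IHn -natr1; ring.
Qed.

Lemma valuation_zp c : c != 0 -> zp_map i c != 0 /\ 0 <= v (zp_map i c).
Proof.
move=> c0; rewrite fmorph_eq0 tofrac_eq0; split; first exact: c0.
by have [n [u [uu ->]]] := padic_neq0 c0; rewrite /= v_ext.2 ?ler0n.
Qed.

Lemma valuation_p : v p%:R = 1.
Proof.
have := v_ext.2 1%N 1 (unitr1 _).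
by rewrite expr1 mulr1 !rmorph_nat.
Qed.

Lemma natp_neq0 : p%:R != 0 :> F.
Proof. by rewrite -(rmorph_nat (zp_map i)); case: (valuation_zp (padic_natp_neq0 pr_p 1)). Qed.

(** If v x < 0, the lower terms of a monic equation of degree m have value at least (m - 1) v x > m
    v x, and cannot add up to x^m. *)
Lemma integral_valuation x : x != 0 -> integralOver (zp_map i) x -> 0 <= v x.
Proof.
move: (zp_map i) valuation_zp => z z_val x0 [q mq /rootP qx]; rewrite leNgt; apply/negP => vx.
(* Zero is treated as having infinite value, because [v 0] is unspecified. *)
pose above t y := y = 0 \/ t <= v y.
have aboveD t y w : above t y -> above t w -> above t (y + w).
  move=> [->|ty]; first by rewrite add0r.
  move=> [->|tz]; first by rewrite addr0; right.
  have [->|y0] := eqVneq y 0; first by rewrite add0r; right.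
  have [->|z0] := eqVneq w 0; first by rewrite addr0; right.
  have [->|yz0] := eqVneq (y + w) 0; first by left.
  by right; apply: le_trans (valuationD v_ext.1 y0 z0 yz0); rewrite le_min ty.
pose m := (size q).-1; have szq : size q = m.+1 by rewrite prednK // size_poly_gt0 monic_neq0.
have : above ((m%:R - 1) * v x) (\sum_(j < m) z (- q`_j) * x ^+ j).
  apply: big_ind; [by left | exact: aboveD|] => j _.
  have [->|qj0] := eqVneq (- q`_j) 0; first by left; rewrite rmorph0 mul0r.
  have [zj0 vzj] := z_val _ qj0; right; rewrite vM ?expf_neq0 // valuationX //.
  have : (j%:R : rat) <= m%:R - 1 by rewrite lerBrDr natr1 ler_nat.
  by nra.
have -> : \sum_(j < m) z (- q`_j) * x ^+ j = x ^+ m.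
  move: qx; rewrite (horner_map_sum _ _ (leqnn _)) szq big_ord_recr /=.
  have -> : q`_m = 1 by rewrite -(monicP mq) lead_coefE.
  rewrite rmorph1 mul1r => /eqP; rewrite addrC addr_eq0 => /eqP ->.
  rewrite -sumrN; apply: eq_bigr => j _.
  by rewrite rmorphN mulNr.
case=> [/eqP|]; first by rewrite expf_eq0 (negPf x0) andbF.
by rewrite valuationX //; lra.
Qed.

(** For the converse, the dichotomy is applied to x and its inverse with e = 1: if x^-d = p s with s
    integral, then v x < 0. *)
Lemma valuation_ringP (D : nat) :
    (forall x, exists f : {poly padic pr_p},
      [/\ f != 0, (size f <= D.+1)%N & (map_poly i f).[x] = 0]) ->
  forall x, valuation_ring v x <-> integralOver (zp_map i) x.
Proof.
move=> algF x; have [->|x0] := eqVneq x 0.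
  by split=> _; [exact: integral0 | left].
split=> [[/eqP|vx]|xi]; last by right; apply: integral_valuation.
  by rewrite (negPf x0).
have [f [f0 szf fx]] := algF x^-1.
have dom1 (y z : F) : 1 * y * z = 0 -> 1 * y = 0 \/ 1 * z = 0.
  by rewrite !mul1r => /eqP; rewrite mulf_eq0 => /orP[/eqP|/eqP]; [left | right].
have fx1 : (map_poly i f).[x^-1] * 1 = 0 by rewrite mulr1 fx.
have [xi|[d [s [/andP[d0 _] si xs]]]] := inverse_integral_or_nilpotent
  (mulr1 1) (oner_neq0 F) dom1 (mulfV x0) (mul1r _) (mul1r _) f0 szf fx1; first exact: xi.
have s0 : s != 0.
  by apply/eqP => s0; move/eqP: xs; rewrite s0 mulr0 expf_eq0 invr_eq0 (negPf x0) andbF.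
have := integral_valuation s0 si; have := congr1 v xs.
rewrite valuationX ?invr_eq0 // vM ?natp_neq0 // valuation_p.
have := vM x0 (_ : x^-1 != 0); rewrite invr_eq0 mulfV // valuation1 => /(_ x0).
have : (0 : rat) < d%:R by rewrite ltr0n.
by nra.
Qed.

End Valuation.

(** * Splitting fields and embeddings *)

Lemma irreducible_factor (F : fieldType) (q : {poly F}) :
  (1 < size q)%N -> exists2 d, irreducible_poly d & d %| q.
Proof.
move=> szq; pose P n := `[< exists d : {poly F}, [/\ (1 < size d)%N, size d = n & d %| q] >].
have exP : exists n, P n by exists (size q); apply/asboolP; exists q.
case: (ex_minnP exP) => n /asboolP[d [szd <- dq]] min_d; exists d => //.
have d0 : d != 0 by rewrite -size_poly_gt0 (ltn_trans _ szd).
split=> // e sze ed; have e0 : e != 0 by apply: contraNneq d0 => e0; rewrite -dvd0p -e0.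
rewrite -dvdp_size_eqp // eqn_leq dvdp_leq //=; apply: min_d; apply/asboolP; exists e.
by split=> //; [rewrite ltn_neqAle eq_sym sze size_poly_gt0 | apply: dvdp_trans dq].
Qed.

(** Roots are adjoined one at a time; stating the result with a bare field and a morphism lets the
    base field change in the induction. *)
Lemma splitting_field_exists (F : fieldType) (q : {poly F}) : q \is monic ->
  exists (E : fieldType) (f : {rmorphism F -> E}) (rs : seq E),
    map_poly f q = \prod_(r <- rs) ('X - r%:P).
Proof.
have [n] := ubnP (size q); elim: n => // n IHn in F q * => szq mq.
have [q1|q1] := leqP (size q) 1.
  exists F, idfun, [::]; rewrite big_nil; suff -> : q = 1 by rewrite rmorph1.
  move: mq; rewrite monicE (size1_polyC q1) lead_coefC => /eqP->.
  by rewrite polyC1.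
have [d irr_d dq] := irreducible_factor q1.
have [L _ [z dz _]] := irredp_FAdjoin irr_d.
have /factor_theorem[q' Dq'] : root (map_poly (in_alg L) q) z.
  have /dvdpP[c ->] := dq; rewrite rmorphM /= rootM dz orbT //.
have mq' : q' \is monic.
  by rewrite -(monicMr _ (monicXsubC z)) -Dq' map_monic.
have [||E [f [rs Drs]]] := IHn _ q'; rewrite ?mq' //.
  rewrite -ltnS (leq_trans _ szq) // ltnS -(size_map_poly (in_alg L) q) Dq'.
  by rewrite size_Mmonic ?monicXsubC ?monic_neq0 // size_XsubC addn2.
exists E, (f \o in_alg L), (f z :: rs).
rewrite map_poly_comp big_cons -Drs Dq' rmorphM /= mulrC.
by rewrite rmorphB /= map_polyX map_polyC.
Qed.

(** L is K[X]/(f) through t, and evaluation at r factors through this quotient. *)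
Lemma extend_to_root (K : fieldType) (L : fieldExtType K) (O : fieldType)
    (iota : {rmorphism K -> O}) (f : {poly K}) (t : L) (r : O) :
    (forall x : L, exists P, x = (map_poly (in_alg L) P).[t]) ->
    (forall P, (map_poly (in_alg L) P).[t] = 0 -> f %| P) ->
    root (map_poly iota f) r ->
  exists s : {rmorphism L -> O}, s t = r /\ forall k, s k%:A = iota k.
Proof.
move=> /choice[P_ PE] f_min fr; pose s x := (map_poly iota (P_ x)).[r].
have sE P : s (map_poly (in_alg L) P).[t] = (map_poly iota P).[r].
  apply/eqP; rewrite -subr_eq0 -hornerN -hornerD -rmorphB /=.
  have /dvdpP[c ->] : f %| P_ (map_poly (in_alg L) P).[t] - P.
    by apply: f_min; rewrite rmorphB hornerD hornerN -PE subrr.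
  by rewrite rmorphM hornerM (rootP fr) mulr0.
have s_zmod : zmod_morphism s.
  by move=> x y; rewrite {1}[x]PE {1}[y]PE -hornerN -hornerD -rmorphB sE rmorphB hornerD hornerN.
have s_mon : monoid_morphism s.
  split; first by have := sE 1; rewrite !rmorph1 !hornerE.
  by move=> x y; rewrite {1}[x]PE {1}[y]PE -hornerM -rmorphM sE rmorphM hornerM.
pose sm : {rmorphism L -> O} := HB.pack s
  (GRing.isZmodMorphism.Build L O s s_zmod) (GRing.isMonoidMorphism.Build L O s s_mon).
exists sm; split=> [|k]; rewrite /sm /=.
  by have := sE 'X; rewrite !map_polyX !hornerX.
by have := sE k%:P; rewrite !map_polyC !hornerC.
Qed.

(** A primitive element t has dim L distinct conjugates, one for each embedding. Invertibility is
    Dedekind's independence: multiplied by the coordinates of the powers of t, the matrix becomes a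
    Vandermonde matrix in these conjugates. *)
Lemma embeddings_exist (K : fieldType) (L : fieldExtType K) : [pchar L] =i pred0 ->
  exists (O : fieldType) (iota : {rmorphism K -> O}) (s : 'I_(dim L) -> {rmorphism L -> O}),
    (forall i k, s i k%:A = iota k) /\
    \matrix_(i, j) s i (r2v (delta_mx 0 j)) \in unitmx.
Proof.
move=> char0; have sepL : separable 1 {:L} by apply/separableP => x _; apply: pcharf0_separable.
have := eq_adjoin_separable_generator sepL (sub1v _).
set t := separable_generator _ _ => Lt.
have /polyOver1P[f Df] := minPolyOver 1 t.
have genL (x : L) : exists P, x = (map_poly (in_alg L) P).[t].
  have /Fadjoin1_polyP[P] : x \in <<1; t>>%VS by rewrite -Lt memvf.
  by exists P.
have min_f P : (map_poly (in_alg L) P).[t] = 0 -> f %| P.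
  move=> /rootP Pt; rewrite -(dvdp_map (in_alg L)) -Df minPoly_dvdp //.
  by apply/polyOver1P; exists P.
have mf : f \is monic by rewrite -(map_monic (in_alg L)) -Df monic_minPoly.
have szf : size f = (dim L).+1.
  rewrite -(size_map_poly (in_alg L)) -Df size_minPoly adjoin_degreeE.
  by rewrite -Lt dimv1 divn1 dimvf.
have sepf : separable_poly f.
  rewrite -(separable_map (in_alg L)) -Df.
  exact: pcharf0_separable.
have [O [iota [rs Drs]]] := splitting_field_exists mf.
have uniq_rs : uniq rs by rewrite -separable_prod_XsubC -Drs separable_map.
have sz_rs : size rs = dim L.
  have := congr1 (fun q : {poly O} => size q) Drs.
  by rewrite size_map_poly size_prod_XsubC szf => -[].
have /choice[s sP] (i : 'I_(dim L)) : exists s : {rmorphism L -> O},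
    s t = rs`_i /\ forall k, s k%:A = iota k.
  apply: extend_to_root genL min_f _.
  by rewrite Drs root_prod_XsubC mem_nth // sz_rs.
exists O, iota, s; split=> [i k|]; first by have [_ ->] := sP i.
set V := \matrix_(i, j) _; pose T := \matrix_(j, k < dim L) iota (v2r (t ^+ k) 0 j).
have : \det (V *m T) != 0.
  have -> : V *m T = (Vandermonde (dim L) (\row_(i < dim L) rs`_i))^T.
    apply/matrixP => i k; rewrite !mxE -(sP i).1 -rmorphXn.
    rewrite -[t ^+ k in RHS]v2rK [v2r _ in RHS]row_sum_delta !linear_sum rmorph_sum.
    apply: eq_bigr => j _; rewrite !mxE linearZ /= -mulr_algl rmorphM (sP i).2.
    by rewrite mulrC.
  rewrite det_tr det_Vandermonde; apply/prodf_neq0 => i _; apply/prodf_neq0 => j lt_ij.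
  by rewrite !mxE subr_eq0 nth_uniq ?sz_rs // eq_sym ltn_eqF.
by rewrite det_mulmx mulf_eq0 negb_or unitmxE unitfE => /andP[].
Qed.

(** * The action of H over a splitting field *)

Lemma integral_fmorph (R : nzRingType) (F E : fieldType) (f : {rmorphism R -> F})
    (g : {rmorphism F -> E}) x :
  integralOver (g \o f) (g x) -> integralOver f x.
Proof. by case=> q mq; rewrite map_poly_comp fmorph_root; exists q. Qed.

(** The trace is the sum of the roots of the characteristic polynomial in a splitting field. *)
Lemma integral_mxtrace (R : comNzRingType) (F : fieldType) (f : {rmorphism R -> F})
    n (X : 'M[F]_n) :
    (forall (E : fieldType) (g : {rmorphism F -> E}) l,
      eigenvalue (map_mx g X) l -> integralOver (g \o f) l) ->
  integralOver f (\tr X).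
Proof.
move=> eig_int; have [n0|n_gt0] := posnP n.
  by move: X {eig_int}; rewrite n0 => X; rewrite /mxtrace big_ord0; apply: integral0.
have [E [g [rs Drs]]] := splitting_field_exists (char_poly_monic X).
have sz_rs : size rs = n.
  have := congr1 (fun q : {poly E} => size q) Drs.
  by rewrite size_map_poly size_prod_XsubC size_char_poly => -[].
apply: (@integral_fmorph _ _ _ _ g); rewrite -trace_map_mx.
rewrite map_char_poly in Drs; rewrite -[\tr _]opprK -char_poly_trace // Drs.
have := @coefPn_prod_XsubC _ rs; rewrite sz_rs => ->; last by rewrite -lt0n.
rewrite opprK big_seq; apply: integral_sum => r rs_r; apply: eig_int.
by rewrite eigenvalue_root_char Drs root_prod_XsubC.
Qed.

Section Representation.
Context (K : fieldType) (L : fieldExtType K) (H : falgType K) (act : {linear H -> 'End(L)}).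
Hypothesis act1 : forall x, act 1 x = x.
Hypothesis actM : forall g h x, act (g * h) x = act g (act h x).
Context (O : fieldType) (iota : {rmorphism K -> O}) (m : nat).
Context (s : 'I_m -> {rmorphism L -> O}) (e : 'I_m -> L).
Hypothesis sK : forall i k, s i k%:A = iota k.
Let V := \matrix_(i, j) s i (e j).
Hypothesis Vu : V \in unitmx.
Hypothesis e_span : forall x, exists c : 'I_m -> K, x = \sum_j c j *: e j.

(** This is the action of h on O ⊗ L, identified with O^m by the embeddings; [invmx V] passes from
    the family [e] to these coordinates. *)
Definition embedding_mx (h : H) : 'M[O]_m :=
  \matrix_(i, j) s i (act h (e j)) *m invmx V.
Local Notation a := embedding_mx.

Lemma s_scale i k x : s i (k *: x) = iota k * s i x.
Proof. by rewrite -mulr_algl rmorphM sK. Qed.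

Lemma embedding_mxE h i x : s i (act h x) = \sum_t a h i t * s t x.
Proof.
have Dj j : s i (act h (e j)) = \sum_t a h i t * s t (e j).
  have /matrixP/(_ i j) : a h *m V = \matrix_(i, j) s i (act h (e j)) by rewrite mulmxKV.
  by rewrite !mxE => <-; apply: eq_bigr => t _; rewrite [V _ _]mxE.
have [c ->] := e_span x; rewrite linear_sum rmorph_sum /=.
transitivity (\sum_j \sum_t a h i t * s t (c j *: e j)).
  apply: eq_bigr => j _; rewrite linearZ /= s_scale Dj mulr_sumr.
  by apply: eq_bigr => t _; rewrite s_scale mulrCA.
by rewrite exchange_big; apply: eq_bigr => t _; rewrite rmorph_sum mulr_sumr.
Qed.

Lemma embedding_mx_uniq h (A : 'M[O]_m) :
  (forall i j, s i (act h (e j)) = \sum_t A i t * s t (e j)) -> a h = A.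
Proof.
move=> AE; rewrite /a -[RHS](mulmxK Vu); congr (_ *m _).
apply/matrixP => i j; rewrite !mxE AE; apply: eq_bigr => t _; by rewrite mxE.
Qed.

Lemma embedding_mx1 : a 1 = 1%:M.
Proof.
apply: embedding_mx_uniq => i j; rewrite act1 (bigD1 i) //= mxE eqxx mul1r.
by rewrite big1 ?addr0 // => t /negPf ti; rewrite mxE eq_sym ti mul0r.
Qed.

Lemma embedding_mxM g h : a (g * h) = a g *m a h.
Proof.
apply: embedding_mx_uniq => i j; rewrite actM embedding_mxE.
transitivity (\sum_t \sum_u a g i t * a h t u * s u (e j)).
  by apply: eq_bigr => t _; rewrite embedding_mxE mulr_sumr; apply: eq_bigr => u _; rewrite mulrA.
by rewrite exchange_big; apply: eq_bigr => u _; rewrite mxE mulr_suml.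
Qed.

Lemma embedding_mxX h n : a (h ^+ n) = (a h : 'M_m) ^+ n.
Proof.
elim: n => [|n IHn]; first by rewrite embedding_mx1.
by rewrite !exprS embedding_mxM IHn.
Qed.

Lemma embedding_mx_sum I (r : seq I) (c : I -> K) (hs : I -> H) :
  a (\sum_(k <- r) c k *: hs k) = \sum_(k <- r) iota (c k) *: a (hs k).
Proof.
apply: embedding_mx_uniq => i j; rewrite linear_sum sum_lfunE rmorph_sum.
transitivity (\sum_(k <- r) \sum_t (iota (c k) *: a (hs k)) i t * s t (e j)).
  apply: eq_bigr => k _; rewrite linearZ /= lfunE /= s_scale embedding_mxE mulr_sumr.
  by apply: eq_bigr => t _; rewrite [fun_of_matrix (_ *: _) _ _]mxE mulrA.
by rewrite exchange_big; apply: eq_bigr => t _; rewrite summxE mulr_suml.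
Qed.

(** An eigenvalue of a(h) satisfies every monic equation that h satisfies. *)
Lemma embedding_eigenvalue_integral (R : comNzRingType) (kap : {rmorphism R -> K}) h
    (E : fieldType) (g : {rmorphism O -> E}) l :
    integralOver (in_alg H \o kap) h -> eigenvalue (map_mx g (a h)) l ->
  integralOver (g \o (iota \o kap)) l.
Proof.
move=> [q mq /rootP qh] /eigenvalueP[u ul u0]; exists q => //; apply/rootP.
have uX k : u *m map_mx g (a (h ^+ k)) = l ^+ k *: u.
  elim: k => [|k IHk]; first by rewrite embedding_mx1 map_mx1 mulmx1 scale1r.
  by rewrite exprSr embedding_mxM map_mxM mulmxA IHk -scalemxAl ul scalerA -exprSr.
have a0 : a 0 = 0.
  by have := embedding_mx_sum [::] (fun _ : nat => 0) (fun=> 0); rewrite !big_nil.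
rewrite (horner_map_sum _ _ (leqnn _)).
have : (\sum_(k < size q) (g \o (iota \o kap)) q`_k * l ^+ k) *: u = 0.
  have := congr1 (fun x => u *m map_mx g (a x)) qh.
  rewrite a0 map_mx0 mulmx0 (horner_map_sum _ _ (leqnn _)) => <-.
  have -> : \sum_(j < size q) (in_alg H \o kap) q`_j * h ^+ j
      = \sum_(j < size q) kap q`_j *: h ^+ j.
    by apply: eq_bigr => j _; rewrite /= mulr_algl.
  rewrite embedding_mx_sum map_mx_sum mulmx_sumr scaler_suml.
  by apply: eq_bigr => j _; rewrite map_mxZ -scalemxAr uX scalerA.
by move/eqP; rewrite scaler_eq0 (negPf u0) orbF => /eqP.
Qed.

Context (hb : 'I_m -> H).
Hypothesis hb_span : forall h, exists c : 'I_m -> K, h = \sum_k c k *: hb k.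
Hypothesis hb_comul : forall h, exists D : 'I_m -> 'I_m -> K, forall x y,
  act h (x * y) = \sum_k \sum_l D k l *: (act (hb k) x * act (hb l) y).
Hypothesis hb_galois : forall j, exists S : 'I_m -> L, forall j',
  \sum_k S k * act (hb k) (e j') = (j == j')%:R.
Hypothesis comH : commutative (@GRing.mul H).

Let B i := \matrix_(k, t) a (hb k) i t.

Let BV i : B i *m V = \matrix_(k, j) s i (act (hb k) (e j)).
Proof.
apply/matrixP => k j; rewrite !mxE embedding_mxE.
by apply: eq_bigr => t _; rewrite !mxE.
Qed.

(** Each map sending e_j to 1 and the other e_j' to 0 is in the image of the Galois map; applying
    [s i] to these expansions gives a left inverse of [B i *m V]. *)
Let Bu i : B i \in unitmx.
Proof.
have /choice[S SP] := hb_galois.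
have : (\matrix_(j, k) s i (S j k)) *m (B i *m V) = 1%:M.
  apply/matrixP => j j'; rewrite BV !mxE -(rmorph_nat (s i)) -SP rmorph_sum.
  by apply: eq_bigr => k _; rewrite !mxE rmorphM.
by move=> /mulmx1_unit[_]; rewrite unitmx_mul => /andP[].
Qed.

(* H-Galois theory over the splitting field in matrix form: the comultiplication *)
(* of H is diagonalized by each of the bases B i of its dual.                    *)
Let B_diag h : exists D, forall i, (B i)^T *m D *m B i = diag_mx (row i (a h)).
Proof.
have [D DP] := hb_comul h; exists (\matrix_(k, l) iota (D k l)) => i; set D' := \matrix_(k, l) _.
suff : V^T *m ((B i)^T *m D' *m B i) *m V = V^T *m diag_mx (row i (a h)) *m V.
  by move/(can_inj (mulmxK Vu))/(can_inj (mulKmx _)); apply; rewrite unitmx_tr.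
have -> : V^T *m ((B i)^T *m D' *m B i) *m V = (B i *m V)^T *m D' *m (B i *m V).
  by rewrite trmx_mul !mulmxA.
rewrite BV; apply/matrixP => j j'.
transitivity (s i (act h (e j * e j'))).
  rewrite DP exchange_big rmorph_sum mxE; apply: eq_bigr => l _.
  rewrite mxE rmorph_sum mulr_suml; apply: eq_bigr => k _.
  by rewrite s_scale rmorphM !mxE mulrA [iota _ * _]mulrC.
rewrite embedding_mxE !mxE; apply: eq_bigr => t _.
by rewrite mul_mx_diag !mxE rmorphM; ring.
Qed.

Context (i0 : 'I_m).
Let C i := invmx (B i0) *m B i.

(** [C i] carries row i0 of each a(h) to row i. Both [B i0] and [B i] diagonalize the same
    comultiplication matrix, which gives the identity for y a row i0 of some a(hb_k); such rows
    span. *)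
Let diagC i y : diag_mx (y *m C i) = (C i)^T *m diag_mx y *m C i.
Proof.
have -> : y = \sum_k (y *m invmx (B i0)) 0 k *: row i0 (a (hb k)).
  rewrite -{1}[y](mulmxKV (Bu i0)) mulmx_sum_row; apply: eq_bigr => k _; congr (_ *: _).
  by apply/rowP => t; rewrite !mxE.
rewrite mulmx_suml !linear_sum /= mulmx_suml; apply: eq_bigr => k _.
rewrite -scalemxAl !linearZ /= -scalemxAl; congr (_ *: _).
have rowB j : row j (a (hb k)) = row k (B j) by apply/rowP => t; rewrite !mxE.
have -> : row i0 (a (hb k)) *m C i = row i (a (hb k)).
  by rewrite !rowB -row_mul mulKVmx.
have [D DP] := B_diag (hb k); rewrite -!DP.
have BC : B i0 *m C i = B i by rewrite mulKVmx.
by rewrite -{1 2}BC trmx_mul !mulmxA.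
Qed.

(* By diagC the rows of C i are 0-1 vectors with disjoint supports, so C i is  *)
(* a permutation matrix.                                                       *)
Let embedding_mx_perm : exists sg : 'I_m -> 'I_m -> 'I_m,
  [/\ forall i, injective (sg i), forall t, sg i0 t = t,
      forall i t h, a h i (sg i t) = a h i0 t &
      forall t, \matrix_(i, j) (j == sg i t)%:R
        = \sum_k invmx (B i0) t k *: a (hb k)].
Proof.
have Cu i : C i \in unitmx by rewrite unitmx_mul unitmx_inv !Bu.
have CC i t u u' : C i t u * C i t u' = C i t u *+ (u == u').
  have := congr1 (fun M : 'M_m => M u u') (diagC i (delta_mx 0 t)).
  rewrite -rowE [RHS]mxE (bigD1 t) //= big1 ?addr0 => [|t' /negPf t't].
    by rewrite mul_mx_diag !mxE !eqxx mulr1.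
  by rewrite mul_mx_diag !mxE t't andbF mulr0 mul0r.
have sg_ex i t : exists u, forall u', C i t u' = (u' == u)%:R.
  have /rV0Pn[u] : row t (C i) != 0.
    apply: contraTneq (Cu i) => /(congr1 (mulmx^~ (invmx (C i)))).
    rewrite mul0mx -row_mul mulmxV // => /rowP/(_ t)/eqP.
    by rewrite !mxE eqxx oner_eq0.
  rewrite mxE => Cu0; have Ctu : C i t u = 1.
    by apply: (mulfI Cu0); rewrite CC eqxx mulr1.
  exists u => u'; have [->|nu] := eqVneq u' u; first by rewrite Ctu.
  by have := CC i t u u'; rewrite Ctu mul1r eq_sym (negPf nu).
have /choice[sg sgP] i : exists f : 'I_m -> 'I_m, forall t u', C i t u' = (u' == f t)%:R.
  by have /choice[f] := sg_ex i; exists f.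
have C0 : C i0 = 1%:M by rewrite /C mulVmx.
have aC i h : row i (a h) = row i0 (a h) *m C i.
  have [c ->] := hb_span h; rewrite embedding_mx_sum.
  have rowS j : row j (\sum_k iota (c k) *: a (hb k)) = \row_k iota (c k) *m B j.
    apply/rowP => t; rewrite !mxE summxE; apply: eq_bigr => k _.
    by rewrite [fun_of_matrix (_ *: _) _ _]mxE !mxE.
  by rewrite !rowS -mulmxA mulKVmx.
have sg_inj i : injective (sg i).
  move=> t t' sgt; apply/eqP; have : row t 1%:M = row t' (1%:M : 'M[O]_m).
    rewrite -(mulmxV (Cu i)) (row_mul t (C i)) (row_mul t' (C i)); congr (_ *m _).
    by apply/rowP => u; rewrite [row t _ _ _]mxE [RHS]mxE !sgP sgt.
  move/rowP/(_ t)/eqP; rewrite !mxE eqxx; have [//|_] := eqVneq t t'.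
  by rewrite oner_eq0.
exists sg; split=> [//|t|i t h|t].
- have := sgP i0 t t; rewrite C0 mxE eqxx; have [<-//|_ /eqP] := eqVneq t (sg i0 t).
  by rewrite oner_eq0.
- have /rowP/(_ (sg i t)) := aC i h; rewrite mxE [RHS]mxE => ->.
  rewrite (bigD1 t) //= big1 => [|t' t't]; first by rewrite sgP eqxx mulr1 addr0 mxE.
  by rewrite sgP (inj_eq (sg_inj i)) eq_sym (negPf t't) mulr0.
(* Entry (i, j) of the sum is [C i t j]: its coefficients define the element of O ⊗ H dual to the
   form h |-> a(h)_(i0 t). *)
apply/matrixP => i j; rewrite mxE -sgP summxE mxE; apply: eq_bigr => k _.
by rewrite [RHS]mxE; congr (_ * _); rewrite mxE.
Qed.

Lemma embedding_mx_integral (R : comUnitRingType) (kap : {rmorphism R -> K}) (h : H) t :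
    (forall n, integralOver (in_alg H \o kap) (h ^+ n)) -> (m%:R : R) \is a GRing.unit ->
  integralOver (iota \o kap) (a h i0 t).
Proof.
move=> h_int m_unit; have [sg [sg_inj sg0 sgP P_sum]] := embedding_mx_perm.
pose P t : 'M[O]_m := \matrix_(i, j) (j == sg i t)%:R.
have P_comm t1 h1 : P t1 *m a h1 = a h1 *m P t1.
  rewrite /P P_sum mulmx_suml mulmx_sumr; apply: eq_bigr => k _.
  by rewrite -scalemxAl -scalemxAr -!embedding_mxM comH.
have PP t1 t2 : P t1 *m P t2 = P t2 *m P t1.
  rewrite {2 3}/P P_sum mulmx_suml mulmx_sumr; apply: eq_bigr => k _.
  by rewrite -scalemxAl -scalemxAr P_comm.
have PPE t1 t2 i j : (P t1 *m P t2) i j = (j == sg (sg i t1) t2)%:R.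
  rewrite mxE (bigD1 (sg i t1)) //= big1 => [|l /negPf nl].
    by rewrite !mxE eqxx mul1r addr0.
  by rewrite mxE nl mul0r.
(* With [sg0] and injectivity, this makes [sg] an abelian group law on the indices with unit i0; t'
   below is the inverse of t. *)
have sgC i t1 t2 : sg (sg i t1) t2 = sg (sg i t2) t1.
  apply/eqP; have := PPE t1 t2 i (sg (sg i t1) t2); rewrite PP PPE eqxx.
  by case: eqP => // _ /eqP; rewrite eq_sym oner_eq0.
have [t' t'P] : exists t', sg t t' = i0.
  by exists (invF (sg_inj t) i0); rewrite f_invF.
have sgK i : sg (sg i t) t' = i.
  by rewrite -{1}(sg0 i) (sgC i0 i t) sg0 sgC t'P sg0.
have sg'_inj : injective (sg^~ t').
  by apply: can_inj (sg^~ t) _ => i; rewrite sgC sgK.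
have sg'E i j : (sg i t' == sg j t') = (i == j) := inj_eq sg'_inj i j.
pose pi := perm sg'_inj.
have Ppi : P t' = perm_mx pi.
  by apply/matrixP => i j; rewrite !mxE permE eq_sym.
have tr_aP : \tr (a h *m P t') = m%:R * a h i0 t.
  transitivity (\sum_(i < m) a h i0 t); last by rewrite sumr_const card_ord mulr_natl.
  apply: eq_bigr => i _; rewrite mxE (bigD1 (sg i t)) //= big1 => [|j ji].
    by rewrite [P t' _ _]mxE sgK eqxx mulr1 addr0 sgP.
  by rewrite [P t' _ _]mxE -[X in X == _](sgK i) sg'E eq_sym (negPf ji) mulr0.
suff tr_int : integralOver (iota \o kap) (\tr (a h *m P t')).
  have -> : a h i0 t = (iota \o kap) (m%:R^-1) * \tr (a h *m P t').
    rewrite tr_aP mulrA -(rmorph_nat (iota \o kap)) -rmorphM mulVr //.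
    by rewrite rmorph1 mul1r.
  by apply: integral_mul => //; apply: integral_id.
apply: integral_mxtrace => E g l; set X := a h *m P t' => /eigenvalueP[u ul u0].
(* The permutation matrix commutes with a(h) and has finite order, so a power of each eigenvalue of
   X is an eigenvalue of a power of a(h), hence integral. *)
have X_pi : (X : 'M_m) ^+ #[pi]%g = a (h ^+ #[pi]%g).
  rewrite embedding_mxX -[X]/((a h : 'M_m) * P t') exprMn_comm; last first.
    by rewrite /GRing.comm -!mulmxE P_comm.
  suff -> : (P t' : 'M_m) ^+ #[pi]%g = 1 by rewrite mulr1.
  have PX n : (P t' : 'M_m) ^+ n = perm_mx (pi ^+ n).
    elim: n => [|n IHn]; first by rewrite expr0 expg0 perm_mx1.
    by rewrite exprS expgS IHn Ppi -mulmxE perm_mxM.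
  by rewrite PX expg_order perm_mx1.
apply: (@integral_exp_root _ _ _ _ #[pi]%g); first exact: order_gt0.
apply: (embedding_eigenvalue_integral (h_int #[pi]%g)).
apply/eigenvalueP; exists u => //; rewrite -X_pi.
elim: #[pi]%g => [|n IHn]; first by rewrite !expr0 map_mx1 mulmx1 scale1r.
by rewrite !exprSr -mulmxE map_mxM mulmxA IHn -scalemxAl ul scalerA -exprSr.
Qed.

End Representation.

(** * The Hopf-Galois condition in coordinates *)

Lemma vector_coord (K : fieldType) (U : vectType K) (x : U) :
  x = \sum_j v2r x 0 j *: r2v (delta_mx 0 j).
Proof.
rewrite -{1}[x]v2rK [v2r x in LHS]row_sum_delta linear_sum.
by apply: eq_bigr => j _; rewrite linearZ.
Qed.

Lemma padic_pchar0 (p : nat) (pr_p : prime p) (F : nzRingType)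
  (i : {rmorphism padic pr_p -> F}) : [pchar F] =i pred0.
Proof.
move=> q; apply/negP => /andP[pr_q /eqP q0].
have : zp_map i q%:R = 0 by rewrite rmorph_nat.
move/eqP; rewrite /zp_map /= fmorph_eq0 tofrac_eq0 => /eqP.
move/(congr1 (fun x : padic_int pr_p => x q)); rewrite residue_nat residue0 modn_small.
  by move=> q_eq0; rewrite q_eq0 in pr_q.
by rewrite ltn_expl // prime_gt1.
Qed.

Section HopfGaloisFacts.
Context (K : fieldType) (H : falgType K) (hH : hopf_algebra H).
Context (L : fieldExtType K) (act : {linear H -> 'End(L)}).
Hypothesis hGal : is_hopf_galois hH act.

Let galoisE (t : tensor L H) x : galois_map act t x =
  \sum_k (\sum_i (t : 'M_(_, _)) i k *: r2v (delta_mx 0 i)) * act (r2v (delta_mx 0 k)) x.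
Proof.
rewrite /galois_map /tlift exchange_big sum_lfunE; apply: eq_bigr => k _.
rewrite sum_lfunE mulr_suml; apply: eq_bigr => i _.
by rewrite lfunE /= lfunE /= lfunE /= scalerAl.
Qed.

Lemma hopf_galois_dim : dim H = dim L.
Proof.
have [_ [f' fK f'K]] := hGal.
pose f : {linear tensor L H -> 'End(L)} := tlift (fun s h => amull s \o act h)%VF.
have := @limg_dim_eq _ _ _ (linfun f) fullv.
have -> : lker (linfun f) = 0%VS.
  by apply/eqP/lker0P => s t; rewrite !lfunE; apply: (can_inj fK).
have -> : (linfun f @: fullv)%VS = fullv.
  apply/eqP; rewrite eqEsubv subvf; apply/subvP => g _.
  by apply/memv_imgP; exists (f' g); rewrite ?memvf // lfunE [RHS]f'K.
rewrite capv0 => /(_ erefl); rewrite !dimvf => dimE.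
have : (dim L * dim L = dim L * dim H)%N := dimE.
by move/eqP; rewrite eqn_pmul2l => [/eqP->|]; rewrite // -dimvf adim_gt0.
Qed.

Lemma hopf_galois_faithful h : act h = 0 -> h = 0.
Proof.
move=> h0; have [_ /bij_inj inj] := hGal.
have : tens (1 : L) h = 0.
  apply: inj; rewrite /galois_map linear0 tlift_tens.
    by apply/lfunP => x; rewrite !lfunE /= !lfunE /= h0 lfunE mulr0.
  split=> [u a g1 g2|g a u1 u2]; apply/lfunP => x; rewrite !lfunE /= !lfunE /= ?lfunE /=.
    by rewrite linearP /= lfunE /= lfunE /= mulrDr -scalerAr lfunE /=.
  by rewrite lfunE /= mulrDl scalerAl.
have : v2r (1 : L) != 0.
  by rewrite -(inj_eq (can_inj r2vK)) ?v2rK linear0 oner_eq0.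
case/rV0Pn => i v1i /matrixP t0; apply: (can_inj v2rK); apply/rowP => j; rewrite linear0 mxE.
have /eqP := t0 i j; rewrite !mxE big_ord1 !mxE mulf_eq0 (negPf v1i) => /eqP->.
by [].
Qed.

(** These are the hypotheses of the matrix computation, for the coordinate basis of H reindexed by
    the embeddings. The last one inverts the Galois map at the j-th coordinate function of L. *)
Lemma hopf_galois_basis (e : dim L = dim H) :
  let hb k := r2v (delta_mx 0 (cast_ord e k)) : H in
  [/\ forall h, exists c : 'I_(dim L) -> K, h = \sum_k c k *: hb k,
      forall h, exists D : 'I_(dim L) -> 'I_(dim L) -> K, forall x y,
        act h (x * y) = \sum_k \sum_l D k l *: (act (hb k) x * act (hb l) y) &
      forall j : 'I_(dim L), exists S : 'I_(dim L) -> L, forall j',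
        \sum_k S k * act (hb k) (r2v (delta_mx 0 j')) = (j == j')%:R].
Proof.
move=> hb; have cast_bij : {on [pred _ | true], bijective (cast_ord e)}.
  by apply/onW_bij/Bijective; [apply: cast_ordK | apply: cast_ordKV].
have [maH [f' fK f'K]] := hGal; split=> [h|h|j].
- exists (fun k => v2r h 0 (cast_ord e k)).
  by rewrite {1}[h]vector_coord (reindex _ cast_bij).
- exists (fun k l => (comul hH h : 'M_(_, _)) (cast_ord e k) (cast_ord e l)) => x y.
  rewrite (act_mul maH) /tlift (reindex _ cast_bij); apply: eq_bigr => k _.
  by rewrite (reindex _ cast_bij).
pose g : 'End(L) := linfun (fun x : L => v2r x 0 j *: (1 : L)).
exists (fun k => \sum_i (f' g : 'M_(_, _)) i (cast_ord e k) *: r2v (delta_mx 0 i)) => j'.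
have <- : g (r2v (delta_mx 0 j')) = (j == j')%:R.
  have gl : linear (fun x : L => v2r x 0 j *: (1 : L)).
    by move=> a x y; rewrite linearP !mxE scalerDl scalerA.
  rewrite /g; pose gL : {linear L -> L} := HB.pack (fun x : L => v2r x 0 j *: (1 : L))
    (GRing.isLinear.Build K L L _ _ gl).
  rewrite -[fun x => _]/(gL : L -> L) lfunE /= r2vK mxE /=.
  by case: (j == j'); rewrite ?scale1r ?scale0r.
transitivity (galois_map act (f' g) (r2v (delta_mx 0 j'))); last by rewrite f'K.
by rewrite galoisE (reindex _ cast_bij).
Qed.

End HopfGaloisFacts.

(** Any embedding reflects integrality, and s_i0 (h x) is the sum of the a(h)_(i0 t) s_t x, whose
    factors are all integral; n is a unit of Z_p because p does not divide it. *)
Lemma hopf_galois_integral (p : nat) (pr_p : prime p) (K : fieldExtType (padic pr_p))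
    (L : fieldExtType K) (H : falgType K) (hH : hopf_algebra H)
    (act : {linear H -> 'End(L)}) h x :
    commutative (@GRing.mul H) -> is_hopf_galois hH act -> ~~ (p %| \dim {:L})%N ->
    integralOver (zp_map (in_alg H \o in_alg K)) h ->
    integralOver (zp_map (in_alg L \o in_alg K)) x ->
  integralOver (zp_map (in_alg L \o in_alg K)) (act h x).
Proof.
move=> comH hGal p_ndvd h_int x_int.
have char0 : [pchar L] =i pred0 := padic_pchar0 (in_alg L \o in_alg K).
have [O [iota [s [sK Vu]]]] := embeddings_exist char0.
have [hb_span hb_comul hb_galois] := hopf_galois_basis hGal (esym (hopf_galois_dim hGal)).
have L_gt0 : (0 < dim L)%N by rewrite -dimvf adim_gt0.
pose i0 : 'I_(dim L) := Ordinal L_gt0.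
pose kap : {rmorphism padic_int pr_p -> K} := zp_map (in_alg K).
have m_unit : ((dim L)%:R : padic_int pr_p) \is a GRing.unit.
  by rewrite padic_unitE residue_nat expn1 -dimvf.
have [maH _] := hGal.
have e_span y : exists c : 'I_(dim L) -> K, y = \sum_j c j *: r2v (delta_mx 0 j).
  by exists (fun j => v2r y 0 j); apply: vector_coord.
have hX_int n : integralOver (in_alg H \o kap) (h ^+ n).
  pose HC : comNzRingType := HB.pack H (GRing.PzRing_hasCommutativeMul.Build H comH).
  exact: (@integral_exp _ HC (zp_map (in_alg H \o in_alg K)) h n h_int).
have s_int i y : integralOver (zp_map (in_alg L \o in_alg K)) y ->
    integralOver (iota \o kap) (s i y).
  move=> /(integral_rmorph (s i)); congr (integralOver _ _); apply/funext => c.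
  by rewrite /= sK.
apply: (@integral_fmorph _ _ _ _ (s i0)).
have -> : integralOver (s i0 \o zp_map (in_alg L \o in_alg K)) (s i0 (act h x))
    = integralOver (iota \o kap) (s i0 (act h x)).
  by congr (integralOver _ _); apply/funext => c; rewrite /= sK.
rewrite (embedding_mxE act sK Vu e_span); apply: integral_sum => t _.
apply: integral_mul; last exact: s_int.
exact: (embedding_mx_integral (act1 maH) (actM maH) sK Vu e_span hb_span hb_comul hb_galois).
Qed.

(** * Lattices over the integral elements of H *)

Lemma poly_factor_X (F : fieldType) (f : {poly F}) : f != 0 ->
  exists k c q, c != 0 /\ f = (q * 'X + c%:P) * 'X^k.
Proof.
move=> f0; have [k [q]] := multiplicity_XsubC f 0.
rewrite f0 /= rootE polyC0 subr0 => q0 ->; exists k, q.[0].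
have /factor_theorem[q'] : root (q - q.[0]%:P) 0.
  by rewrite /root hornerD hornerN hornerC subrr.
by rewrite polyC0 subr0 => Dq; exists q'; rewrite -Dq subrK.
Qed.

Section LatticeGenerator.
Context (p : nat) (pr_p : prime p) (A : comNzRingType) (i : {rmorphism padic pr_p -> A}).
Context (V : zmodType) (ac : A -> V -> V) (O : V -> Prop) (D : nat) (rank : A -> nat).
Local Notation int := (integralOver (zp_map i)).
Hypothesis ac1 : forall y, ac 1 y = y.
Hypothesis acM : forall g h y, ac (g * h) y = ac g (ac h y).
Hypothesis acDl : forall g h y, ac (g + h) y = ac g y + ac h y.
Hypothesis acDr : forall g y z, ac g (y + z) = ac g y + ac g z.
Hypothesis O0 : O 0.
Hypothesis OD : forall y z, O y -> O z -> O (y + z).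
Hypothesis O_int : forall h y, int h -> O y -> O (ac h y).
Hypothesis O_absorbing : forall y, exists r, O (ac (p%:R ^+ r) y).
Hypothesis O_separated : forall y, y <> 0 -> exists r, forall z, O z -> y <> ac (p%:R ^+ r) z.
Hypothesis ac_faithful : forall h, (forall y, ac h y = 0) -> h = 0.
Hypothesis A_algebraic : forall h, exists f : {poly padic pr_p},
  [/\ f != 0, (size f <= D.+1)%N & (map_poly i f).[h] = 0].
Hypothesis rank_lt : forall e f, e * e = e -> f * f = f -> e * f = f -> f <> e ->
  (rank f < rank e)%N.

Let ac0l y : ac 0 y = 0.
Proof. by apply: (addIr (ac 0 y)); rewrite -acDl !add0r. Qed.

Let ac0r g : ac g 0 = 0.
Proof. by apply: (addIr (ac g 0)); rewrite -acDr !add0r. Qed.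

Let pK r : exists c, p%:R ^+ r * c = 1 :> A.
Proof.
exists (i (p%:R ^- r)); rewrite -(rmorph_nat i) -rmorphXn -rmorphM mulfV ?rmorph1 //.
rewrite expf_neq0 // -(rmorph_nat (@FracField.tofrac (padic_int pr_p))) tofrac_eq0.
exact: padic_natp_neq0 1.
Qed.

Let idem_int e : e * e = e -> int e.
Proof.
move=> ee; exists ('X * ('X - 1)); first by rewrite monicMl ?monicX ?monicXsubC.
by rewrite rmorphM rmorphB /= map_polyX rmorph1 /root !hornerE mulrBr ee mulr1 subrr.
Qed.

(** With c = p^-r, h maps O into p^r O for every r, hence kills O; every vector has a p-power
    multiple in O, so h acts as 0. *)
Let bounded_eq0 h : (forall c, int (c * h)) -> h = 0.
Proof.
move=> h_int; have h_small y : O y -> ac h y = 0.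
  move=> Oy; apply: contrapT => /O_separated[r]; have [c pc] := pK r.
  by move/(_ _ (O_int (h_int c) Oy)); rewrite -acM mulrA pc mul1r.
apply: ac_faithful => y; have [r Oy] := O_absorbing y; have [c pc] := pK r.
by rewrite -[y]ac1 -pc mulrC acM -acM mulrC acM (h_small _ Oy) ac0r.
Qed.

(** All multiples of a nilpotent element are nilpotent, hence integral. *)
Let nilpotent_eq0 (a : A) k : a ^+ k = 0 -> a = 0.
Proof.
case: k => [|k ak0]; first by rewrite expr0 => /eqP; rewrite oner_eq0.
apply: bounded_eq0 => c; apply: (@integral_exp_root _ _ _ _ k.+1) => //.
by rewrite exprMn ak0 mulr0; apply: integral0.
Qed.

(** As integral elements preserve O, the h in e A with h b in O are then exactly the integral
    ones. *)
Let generates e b := [/\ O b, ac e b = b & forall h, O (ac h b) -> int (e * h)].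

(* If no b generated, the chain of better and better candidates would write a  *)
(* fixed b0 as an integral multiple of arbitrarily high powers of a non-unit.  *)
Let local_generator e : e * e = e -> e != 0 ->
  (forall h, e * h != 0 -> exists g, e * h * g = e) -> exists b, generates e b.
Proof.
move=> ee e0 e_field.
have e_dom x y : e * x * y = 0 -> e * x = 0 \/ e * y = 0.
  move=> exy; have [|/e_field[g exg]] := eqVneq (e * x) 0; [by left | right].
  by rewrite -{1}exg mulrAC exy mul0r.
have dich a g : a * g = e -> e * a = a -> e * g = g ->
    int a \/ exists d s, [/\ (0 < d <= D)%N, int s & g ^+ d = p%:R * s].
  move=> ag ea eg; have [f [f0 szf fg]] := A_algebraic g.
  apply: (inverse_integral_or_nilpotent ee e0 e_dom ag ea eg f0 szf).
  by rewrite fg mul0r.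
have p_int : int p%:R by apply: integral_nat.
have dich_int a g : a * g = e -> e * a = a -> e * g = g -> int a \/ int g.
  move=> ag ea eg; case: (dich a g ag ea eg) => [|[d [s [/andP[d0 _] s_int gd]]]].
    by left.
  right.
  by apply: integral_exp_root d0 _; rewrite gd; apply: integral_mul.
pose S y := [/\ O y, ac e y = y & y <> 0].
have [b0 Sb0] : exists y, S y.
  have [y ey] : exists y, ac e y <> 0.
    apply: contrapT => /forallNP ey; move/eqP: e0; apply.
    by apply: ac_faithful => y; apply: contrapT (ey y).
  have [r Oy] := O_absorbing y; have [c pc] := pK r.
  exists (ac e (ac (p%:R ^+ r) y)); split; first exact: O_int (idem_int ee) Oy.
    by rewrite -acM ee.
  move/(congr1 (ac c)); rewrite -!acM ac0r mulrAC [c * _]mulrC pc mul1r; exact: ey.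
apply: contrapT => no_gen.
pose nonunit g := exists a, [/\ a * g = e, e * a = a, e * g = g & ~ int a].
(* As y does not generate, h y lies in O for some h with e h not integral; y' is e h y and g the
   inverse of e h in e A. *)
have step y : S y -> exists g y', [/\ S y', nonunit g & y = ac g y'].
  move=> [Oy ey y0]; have [h [Oh eh]] : exists h, O (ac h y) /\ ~ int (e * h).
    apply: contrapT => /forallNP bad; apply: no_gen; exists y; split=> // h Oh.
    by apply: contrapT => eh; apply: (bad h).
  have [|g ehg] := e_field h.
    by apply: contra_notN eh => /eqP->; apply: integral0.
  have gy : ac (e * g) (ac (e * h) y) = y.
    by rewrite -acM mulrACA ee [g * h]mulrC mulrA ehg.
  exists (e * g), (ac (e * h) y); split=> //.
    split; last by move=> h0; apply: y0; rewrite -gy h0 ac0r.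
      by rewrite acM; apply: O_int (idem_int ee) Oh.
    by rewrite -acM mulrA ee.
  exists (e * h); split=> //; rewrite ?mulrA ?ee //.
  by rewrite [e * h * e]mulrC mulrA ee.
have chain k : exists y g t, [/\ S y, nonunit g, int t & b0 = ac (t * g ^+ k) y].
  elim: k => [|k [y [g [t [Sy [a [ag ea eg a_nint]] t_int Db0]]]]].
    have [g [y [_ ng _]]] := step _ Sb0.
    by exists b0, g, 1; split=> //; [apply: integral1 | rewrite mulr1 ac1].
  have [g' [y' [Sy' [a' [ag' ea' eg' a'_nint]] Dy]]] := step _ Sy.
  (* The quotients g'/g and g/g' are inverse to each other, so one is integral. The product g^k g'
     is then an integral multiple of a (k+1)-st power of g or of g'. *)
  have uw : g' * a * (a' * g) = e.
    have -> : g' * a * (a' * g) = (a' * g') * (a * g) by ring.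
    by rewrite ag ag' ee.
  have [||u_int|w_int] := dich_int _ _ uw; rewrite ?mulrA ?eg' ?ea' //.
    exists y', g, (t * (g' * a)); split=> //; [by exists a | exact: integral_mul|].
    rewrite Db0 Dy -acM; congr (ac _ _).
    by rewrite -[g' in LHS]eg' -ag exprS; ring.
  exists y', g', (t * (a' * g) ^+ k); split=> //; first by exists a'.
    by apply: integral_mul => //; apply: integral_exp.
  rewrite Db0 Dy -acM; congr (ac _ _).
  by rewrite -[g in LHS]eg -ag' exprS !exprMn; ring.
have [Ob0 _ b0_neq0] := Sb0; have [r] := O_separated b0_neq0.
(* As g^d = p s with d at most D, the power g^(r D) is p^r times an integral element, which puts b0
   in p^r O. *)
have [y [g [t [[Oy _ _] [a [ag ea eg a_nint]] t_int Db0]]]] := chain (r * D)%N.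
have [//|[d [s [/andP[d0 dD] s_int gd]]]] := dich _ _ ag ea eg.
have [//|g_int] := dich_int _ _ ag ea eg.
move/(_ (ac (t * (s ^+ r * g ^+ (r * (D - d)))) y)); rewrite -acM; apply.
  apply: O_int => //; apply: integral_mul => //.
  by apply: integral_mul; apply: integral_exp.
rewrite Db0; congr (ac _ _).
have -> : (r * D = d * r + r * (D - d))%N.
  by rewrite mulnBr [(d * r)%N]mulnC subnKC // leq_mul2l dD orbT.
by rewrite exprD exprM gd exprMn; ring.
Qed.

(** Induction on the size of an idempotent e: if e A is not a field it contains a smaller idempotent
    f, and generators for f and e - f add up to one for e. *)
Lemma lattice_generator : exists b,
  [/\ O b, forall h, O (ac h b) -> int h & forall h, ac h b = 0 -> h = 0].
Proof.
suff gen e : e * e = e -> exists b, generates e b.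
  have [b [Ob _ gb]] := gen 1 (mulr1 1).
  have b_int h : O (ac h b) -> int h by move/gb; rewrite mul1r.
  exists b; split=> // h hb; apply: bounded_eq0 => c.
  by apply: b_int; rewrite acM hb ac0r.
have [n] := ubnP (rank e); elim: n => // n IHn in e * => rank_e ee.
have [->|e0] := eqVneq e 0.
  by exists 0; split; rewrite ?ac0r // => h _; rewrite mul0r; apply: integral0.
have [e_field|] := pselect (forall h, e * h != 0 -> exists g, e * h * g = e).
  exact: local_generator.
move=> /existsNP[h /not_implyP[eh0 /forallNP eh_nonunit]]; pose a := e * h.
have ea : e * a = a by rewrite mulrA ee.
move: eh0 eh_nonunit; rewrite -/a; clearbody a => a0 a_nonunit.
(* The lowest nonzero term of a polynomial killing a is solved for a^k, so the powers of a generate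
   a stationary chain of ideals. *)
have [k [g ak]] : exists k g, a ^+ k = a ^+ k.+1 * g.
  have [f [f0 _ fa]] := A_algebraic a.
  have [k [c [q [c0 Df]]]] := poly_factor_X f0.
  have evE : ((map_poly i q).[a] * a + i c) * a ^+ k = 0.
    rewrite -fa Df rmorphM rmorphXn rmorphD rmorphM /= map_polyX map_polyC.
    by rewrite hornerM hornerD hornerM hornerXn hornerX hornerC.
  have cK : i c^-1 * i c = 1 by rewrite -rmorphM mulVf ?rmorph1.
  move: (map_poly i q).[a] (i c^-1) (i c) cK evE => w c1 c2 cK evE.
  exists k, (- w * c1); apply/eqP; rewrite -subr_eq0 -{1}[a ^+ k]mul1r -cK.
  by rewrite -(mulr0 c1) -evE exprS; apply/eqP; ring.
have akj j : a ^+ k.+1 = a ^+ (k.+1 + j) * g ^+ j.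
  elim: j => [|j IHj]; first by rewrite addn0 mulr1.
  have E : a ^+ (k.+1 + j) = a ^+ (k.+1 + j).+1 * g.
    by rewrite addSnnS -addSn !exprD mulrAC -ak.
  by rewrite {1}IHj {1}E addnS [g ^+ j.+1]exprS mulrA.
(* f generates the stable ideal: it is nonzero as a is not nilpotent, and differs from e as a is not
   invertible in e A. *)
pose f := a ^+ k.+1 * g ^+ k.+1.
have af : a ^+ k.+1 * f = a ^+ k.+1 by rewrite [RHS](akj k.+1) mulrA -exprD.
have ff : f * f = f by rewrite {2}/f mulrA [f * _]mulrC af.
have ef : e * f = f by rewrite /f exprS !mulrA ea.
have f0 : f <> 0.
  by move=> f0; move/eqP: a0; apply; apply: (@nilpotent_eq0 _ k.+1); rewrite -af f0 mulr0.
have fe : f <> e.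
  move=> fe; apply: (a_nonunit (a ^+ k * g ^+ k.+1)).
  by rewrite -[RHS]fe /f [a ^+ k.+1]exprS mulrA.
have split_idem : (e - f) * (e - f) = e - f.
  by rewrite mulrBl !mulrBr ee ff [f * e]mulrC ef subrr subr0.
have ef_f : f * (e - f) = 0 by rewrite mulrBr ff mulrC ef subrr.
have e_ef : e * (e - f) = e - f by rewrite mulrBr ee ef.
have ef_e : e - f <> e.
  by move=> E; apply: f0; rewrite -[f](subKr e) E subrr.
have [b1 [Ob1 fb1 gen1]] := IHn f (leq_trans (rank_lt ee ff ef fe) (ltnSE rank_e)) ff.
have [b2 [Ob2 fb2 gen2]] :=
  IHn (e - f) (leq_trans (rank_lt ee split_idem e_ef ef_e) (ltnSE rank_e)) split_idem.
exists (b1 + b2); split=> [||h' Oh].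
- exact: OD.
- by rewrite acDr -fb1 -fb2 -!acM ef e_ef.
have -> : e * h' = f * h' + (e - f) * h' by rewrite -mulrDl addrC subrK.
have fb2_0 : ac f b2 = 0 by rewrite -fb2 -acM ef_f ac0l.
have efb1_0 : ac (e - f) b1 = 0 by rewrite -fb1 -acM mulrC ef_f ac0l.
apply: integral_add; [apply: gen1 | apply: gen2].
  have := O_int (idem_int ff) Oh.
  by rewrite -acM mulrC acM acDr fb1 fb2_0 addr0.
have := O_int (idem_int split_idem) Oh.
by rewrite -acM mulrC acM acDr fb2 efb1_0 add0r.
Qed.

End LatticeGenerator.

(** * Freeness of the valuation ring on one generator *)

Lemma fsfun_unit_sum (H L : zmodType) (F : H -> L) (c : {fsfun unit -> H with 0}) :
  F 0 = 0 -> \sum_(i <- finsupp c) F (c i) = F (c tt).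
Proof.
move=> F0; have [/eqP c0|c0] := boolP (c tt == 0).
  by rewrite c0 F0 big1 // => -[]; rewrite c0.
have -> : finsupp c = [fset tt]%fset.
  by apply/fsetP => -[]; rewrite mem_finsupp c0 inE eqxx.
by rewrite big_seq_fset1.
Qed.

(** f H lies in e H, and if e were in f H then f e = e, so f = e. *)
Lemma idempotent_rank_lt (K : fieldType) (H : falgType K) (e f : H) :
    commutative (@GRing.mul H) -> e * e = e -> f * f = f -> e * f = f -> f <> e ->
  (\dim (limg (amulr f)) < \dim (limg (amulr e)))%N.
Proof.
move=> comH ee ff ef fe.
have sub_fe : (limg (amulr f) <= limg (amulr e))%VS.
  apply/subvP => _ /memv_imgP[x _ ->]; apply/memv_imgP; exists (x * f); rewrite ?memvf //.
  by rewrite !lfunE /= -mulrA [f * e]comH ef.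
rewrite (ltn_leqif (dimv_leqif_sup sub_fe)); apply/negP => sub_ef.
have /(subvP sub_ef)/memv_imgP[x _] : e \in limg (amulr e).
  by apply/memv_imgP; exists 1; rewrite ?memvf // lfunE /= mul1r.
by rewrite lfunE /= => ex; apply: fe; rewrite -ef ex -mulrA ff.
Qed.

Theorem theorem1p2 (p : nat) (pr_p : prime p)
    (K : fieldExtType (padic pr_p)) (L : fieldExtType K)
    (v : L -> rat)
    (v_padic : extends_padic_valuation (@tower_embedding _ K L) v)
    (H : falgType K) (hH : hopf_algebra H)
    (comH : commutative (@GRing.mul H))
    (act : {linear H -> 'End(L)})
    (hGal : is_hopf_galois hH act)
    (p_ndvd : ~~ (p %| \dim {:L})%N) :
  is_free_module act (associated_order act (valuation_ring v))
    (valuation_ring v).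
Proof.
pose iL : {rmorphism padic pr_p -> L} := in_alg L \o in_alg K.
have v_ext : extends_padic_valuation iL v := v_padic.
have v_int := valuation_ringP v_ext (@falgebra_algebraic _ K L).
have [maH _] := hGal.
pose HC : comNzRingType := HB.pack H (GRing.PzRing_hasCommutativeMul.Build H comH).
pose iH : {rmorphism padic pr_p -> HC} := in_alg H \o in_alg K.
have actN n y : act n%:R y = n%:R * y.
  elim: n => [|n IHn]; first by rewrite linear0 lfunE mul0r.
  by rewrite -[in LHS]natr1 linearD lfunE /= IHn (act1 maH) -[in RHS]natr1 mulrDl mul1r.
have p0 r : p%:R ^+ r != 0 :> L by rewrite expf_neq0 // (natp_neq0 v_ext).
have vp r y : y != 0 -> v (p%:R ^+ r * y) = r%:R + v y.
  move=> y0; rewrite (valuationM v_ext.1) // (valuationX v_ext) ?(natp_neq0 v_ext) //.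
  by rewrite (valuation_p v_ext) mulr1.
have O_add y z : valuation_ring v y -> valuation_ring v z -> valuation_ring v (y + z).
  by rewrite !v_int; apply: integral_add.
have O_int h y : integralOver (zp_map iH) h -> valuation_ring v y -> valuation_ring v (act h y).
  by rewrite !v_int; apply: hopf_galois_integral comH hGal p_ndvd.
have O_abs y : exists r, valuation_ring v (act (p%:R ^+ r) y).
  have [->|y0] := eqVneq y 0; first by exists 0%N; rewrite linear0; left.
  exists (Num.bound `|v y|); rewrite -natrX actN natrX; right; rewrite vp //.
  have := archi_boundP (normr_ge0 (v y)); have := ler_norm (- v y); rewrite normrN; lra.
have O_sep y : y <> 0 -> exists r, forall z, valuation_ring v z -> y <> act (p%:R ^+ r) z.
  move=> /eqP y0; exists (Num.bound `|v y|) => z Oz; rewrite -natrX actN natrX => Dy.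
  have z0 : z != 0 by apply: contraNneq y0 => z0; rewrite Dy z0 mulr0.
  have vz : 0 <= v z by case: Oz => // /eqP; rewrite (negPf z0).
  have vy := congr1 v Dy; rewrite vp // in vy.
  have := archi_boundP (normr_ge0 (v y)); have := ler_norm (v y); lra.
have act_inj h : (forall y, act h y = 0) -> h = 0.
  move=> h0; apply: (hopf_galois_faithful hGal); apply/lfunP => y.
  by rewrite h0 lfunE.
have actDl g h y : act (g + h) y = act g y + act h y by rewrite linearD lfunE.
have actDr g y z : act g (y + z) = act g y + act g z by rewrite linearD.
have [b [Ob b_int b_inj]] := @lattice_generator p pr_p HC iH L (fun h => act h)
  (valuation_ring v) (dim H * dim K) (fun e => \dim (limg (amulr (e : H))))
  (act1 maH) (actM maH) actDl actDr (or_introl erefl) O_add O_int O_abs O_sep act_inj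
  (@falgebra_algebraic _ K H) (fun e f => @idempotent_rank_lt _ _ e f comH).
(* h |-> h b is injective by [b_inj], and H and L have equal dimension. *)
have act_surj x : exists h, x = act h b.
  have act_lin : linear (fun h => act h b).
    by move=> k g h; rewrite linearP lfunE /= lfunE.
  pose actL : {linear H -> L} := HB.pack (fun h => act h b)
    (GRing.isLinear.Build K H L _ _ act_lin).
  have ker0 : lker (linfun actL) = 0%VS.
    apply/eqP; rewrite -subv0; apply/subvP => h.
    by rewrite memv_ker lfunE memv0 /= => /eqP /b_inj->.
  have /memv_imgP[h _ ->] : x \in limg (linfun actL); last by exists h; rewrite lfunE.
  suff -> : limg (linfun actL) = fullv by rewrite memvf.
  apply/eqP; rewrite eqEdim subvf limg_dim_eq ?ker0 ?capv0 //.
  by rewrite !dimvf (hopf_galois_dim hGal) leqnn.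
exists unit, (fun=> b); split=> // x Ox; have [h Dx] := act_surj x.
have sumE (c : {fsfun unit -> H with 0}) :
    \sum_(i <- finsupp c) act (c i) b = act (c tt) b.
  by apply: (fsfun_unit_sum (F := fun h => act h b)); rewrite linear0 lfunE.
exists [fsfun i in [fset tt]%fset => h | 0]; split.
  split; last by rewrite sumE fsfunE inE eqxx.
  (* h b = x is in the valuation ring, so h is integral and hence in the associated order. *)
  move=> []; rewrite fsfunE inE eqxx => y Oy; apply: O_int Oy; apply: b_int.
  by rewrite -Dx.
move=> c [_]; rewrite sumE => Dx'; apply/fsfunP => -[]; rewrite fsfunE inE eqxx.
apply/eqP; rewrite -subr_eq0; apply/eqP/b_inj.
by rewrite linearB lfunE /= lfunE /= -Dx -Dx' subrr.
Qed.
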